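(* Let $f \in C((0,\infty);(0,\infty))$ be asymptotically increasing with $\lim_{x\to\infty} f(x)/x = \infty$, let $w \in C([0,\infty);[0,\infty))$ with $w(0)>0$, and let $h \in C(\mathbb{R};\mathbb{R})$ satisfy $H(t) := \int_0^t h(s)\,ds \ge 0$ for each $t\ge 0$. Consider \[ x'(t) = h(t) + \int_0^t w(t-s) f(x(s))\,ds, \quad t \ge 0; \qquad x(0)=\psi>0. \] If \[ \int_\eta^\infty \frac{du}{\sqrt{\int_0^u f(s)\,ds}} < \infty \quad \text{for some } \eta>0, \] then solutions blow up in finite time. If in addition $f$ preserves superexponential growth and $f$ is increasing, then solutions satisfy \[ \lim_{t\to T^-} \frac{F_B(x(t))}{T-t} = \sqrt{2w(0)}, \] where $T$ is the blow-up time and $F_B(x) = \int_x^\infty \frac{du}{\sqrt{\int_0^u f(s)\,ds}}$ for $x>0$.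
   Context: ''$f$ is asymptotically increasing'' means that there is a continuous increasing function $\phi:(0,\infty)\to(0,\infty)$ with $f(x)/\phi(x)\to 1$ as $x\to\infty$. A function $g \in C((0,\infty);(0,\infty))$ exhibits superexponential growth if $g(x)\to\infty$ as $x\to\infty$ and $\lim_{x\to\infty} g(x-\epsilon)/g(x) = 0$ for each $\epsilon>0$. A function $\phi \in C((0,\infty);(0,\infty))$ preserves superexponential growth if for every $g$ exhibiting superexponential growth and every $\epsilon>0$, $\lim_{x\to\infty}\phi(g(x-\epsilon))/\phi(g(x)) = 0$. A solution blows up in finite time if there is $T>0$ with $x$ continuous on $[0,T)$ and $\lim_{t\to T^-}|x(t)|=\infty$; the minimal such $T$ is the blow-up time. *)

(* Defs.v *)
From HB Require Import structures.
From mathcomp Require Import all_boot all_order all_algebra.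
From mathcomp Require Import all_classical all_reals all_analysis.
Set Implicit Arguments. Unset Strict Implicit. Unset Printing Implicit Defensive.
Import Order.TTheory GRing.Theory Num.Theory.
Import numFieldNormedType.Exports.
Local Open Scope classical_set_scope.
Local Open Scope ring_scope.

Section Defs.
Variable R : realType.
Notation mu := (@lebesgue_measure R).

Definition incr_pos (f : R -> R) : Prop :=
  forall a b, 0 < a -> a < b -> f a < f b.

Definition asympt_increasing (f : R -> R) : Prop :=
  exists phi : R -> R,
    {within `]0, +oo[, continuous phi} /\
    (forall x, 0 < x -> 0 < phi x) /\
    incr_pos phi /\
    (f x / phi x @[x --> +oo] --> (1:R)).

Definition pos_cont (g : R -> R) : Prop :=
  {within `]0, +oo[, continuous g} /\ (forall x, 0 < x -> 0 < g x).

Definition superexp (g : R -> R) : Prop :=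
  pos_cont g /\ (g x @[x --> +oo] --> +oo) /\
  (forall eps, 0 < eps -> g (x - eps) / g x @[x --> +oo] --> (0:R)).

Definition preserves_superexp (phi : R -> R) : Prop :=
  pos_cont phi /\
  forall g, superexp g -> forall eps, 0 < eps ->
    phi (g (x - eps)) / phi (g x) @[x --> +oo] --> (0:R).

Definition Hint (h : R -> R) (t : R) : R := Rintegral mu `[0, t] h.

Definition Fint (f : R -> R) (u : R) : R :=
  fine (\int[mu]_(s in `]0%R, u]) (f s)%:E)%E.

Definition FB (f : R -> R) (x : R) : R :=
  fine (\int[mu]_(u in `[x, +oo[) ((Num.sqrt (Fint f u))^-1)%:E)%E.

(* the integral condition: for some eta > 0, int_eta^oo du/sqrt(int_0^u f) < oo
   (including that int_0^eta f, hence every int_0^u f, is finite) *)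
Definition osgood_cond (f : R -> R) : Prop :=
  exists eta : R, 0 < eta /\
    (\int[mu]_(s in `]0%R, eta]) (f s)%:E < +oo)%E /\
    (\int[mu]_(u in `[eta, +oo[) ((Num.sqrt (Fint f u))^-1)%:E < +oo)%E.

Definition dom0 (T : \bar R) : set R := [set t | 0 <= t /\ (t%:E < T)%E].

Definition rhs (f w h x : R -> R) (t : R) : R :=
  h t + Rintegral mu `[0, t] (fun s => w (t - s) * f (x s)).

Definition is_sol (f w h : R -> R) (psi : R) (T : \bar R) (x : R -> R) : Prop :=
  [/\ (0 < T)%E, x 0 = psi,
      {within dom0 T, continuous x},
      (forall t, t \in dom0 T -> 0 < x t) &
      (forall t, 0 < t -> (t%:E < T)%E -> is_derive t 1 x (rhs f w h x t))].

Definition is_max_sol (f w h : R -> R) (psi : R) (T : \bar R) (x : R -> R) : Prop :=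
  is_sol f w h psi T x /\
  ~ (exists (T' : \bar R) (y : R -> R),
       (T < T')%E /\ is_sol f w h psi T' y /\ (forall t, t \in dom0 T -> y t = x t)).

End Defs.

(* Main.v *)
Require Import Defs.
From HB Require Import structures.
From mathcomp Require Import all_boot all_order all_algebra.
From mathcomp Require Import all_classical all_reals all_analysis.
From mathcomp Require Import measurable_realfun ring lra.
Import Order.TTheory GRing.Theory Num.Theory.
Import numFieldNormedType.Exports.
Local Open Scope classical_set_scope.
Local Open Scope ring_scope.
Set Implicit Arguments.
Unset Strict Implicit.
Unset Printing Implicit Defensive.

(* Subtracting H, the function z = x - H is nondecreasing with z >= psi and
   z' = int_0^t w(t-s) f(x(s)) ds.

   No global solution: f is increasing up to a factor k > 0 and w >= m > 0 near 0,
   so on a short window after t0 the function z stays above the function Z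
   with Z'' = m f(x) >= m k f(Z), Z'(t0) = 0, Z(t0) = z(t0).  Multiplying by Z'
   gives Z'^2 >= 2 m k (F(Z) - F(Z(t0))) with F(u) = int_0^u f; since f(u)/u -> oo,
   Z doubles within half of the window, after which Z' >= K sqrt(F(Z)) and F_B(Z)
   decreases at rate at least K.  This forces F_B to be bounded below at
   arbitrarily large arguments, a contradiction.

   Blow-up: if a maximal solution on [0, Tf) were bounded it would have a limit
   at Tf and could be continued.  As f is merely continuous, the continuation is
   of Peano type: delayed equations are solved by finitely many iterations and
   their equi-Lipschitz solutions converge along an ultrafilter.

   Rate: I(t) = int_0^t f(x) tends to infinity at Tf, and since the mass of I
   concentrates at Tf, x' ~ w(0) I.  As I' = f(x), l'Hopital's rule gives
   F(x) ~ w(0) I^2 / 2, so x' ~ sqrt(2 w(0) F(x)), and a second application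
   to F_B(x(t)) / (Tf - t) concludes. *)

(** * Calculus on the line *)

Section Calculus.
Variable R : realType.
Notation mu := (@lebesgue_measure R).
Implicit Types (g k w : R -> R) (a b c t : R).

Lemma is_derive_continuous g t c : is_derive t 1 g c -> {for t, continuous g}.
Proof. by move=> d; apply/differentiable_continuous/derivable1_diffP; apply: ex_derive. Qed.

Lemma derive_ge (m : R) (g dg : R -> R) a b : a <= b ->
  {within `[a, b], continuous g} ->
  (forall t, a < t < b -> is_derive t 1 g (dg t)) ->
  (forall t, a < t < b -> m <= dg t) -> m * (b - a) <= g b - g a.
Proof.
rewrite le_eqVlt => /predU1P[<- _ _ _|ab cg dgg mdg]; first by rewrite !subrr mulr0.
have dgg' t : t \in `]a, b[ -> is_derive t 1 g (dg t) by rewrite in_itv; exact: dgg.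
have [t] := MVT ab dgg' cg; rewrite in_itv/= => tab ->; rewrite ler_wpM2r ?subr_ge0 ?(ltW ab)//; exact: mdg.
Qed.

Lemma derive_le (m : R) (g dg : R -> R) a b : a <= b ->
  {within `[a, b], continuous g} ->
  (forall t, a < t < b -> is_derive t 1 g (dg t)) ->
  (forall t, a < t < b -> dg t <= m) -> g b - g a <= m * (b - a).
Proof.
move=> ab cg dgg mdg.
rewrite -lerN2 opprB -mulNr.
have -> : g a - g b = (- g) b - (- g) a by rewrite !fctE opprK addrC.
apply: (@derive_ge _ _ (fun t => - dg t)) => //.
- by move=> t; apply: continuousN; exact: cg.
- by move=> t tab; apply: is_deriveN; exact: dgg.
- by move=> t tab; rewrite lerN2 mdg.
Qed.

(** Precomposing with a clamp into [A] turns a function controlled only on [A] into one continuous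
    on the whole line. The extensions of [f], [w] and [x] below are all obtained this way. *)
Lemma continuous_comp_within (A : set R) g k : {within A, continuous g} ->
  continuous k -> (forall t, A (k t)) -> continuous (g \o k).
Proof.
move=> /subspace_continuousP cg ck Ak t.
have := cg (k t) (Ak t) => H V /= /H /= VV.
have : \forall s \near t, A (k s) -> V (g (k s)) by exact: ck t _ VV.
by apply: filterS => s /=; apply; exact: Ak.
Qed.

Lemma continuous_funB g k : continuous g -> continuous k ->
  continuous (fun t => g t - k t).
Proof. by move=> cg ck t; apply: continuousB; [exact: cg|exact: ck]. Qed.

Lemma continuous_funD g k : continuous g -> continuous k ->
  continuous (fun t => g t + k t).
Proof. by move=> cg ck t; apply: continuousD; [exact: cg|exact: ck]. Qed.

Lemma continuous_funM g k : continuous g -> continuous k ->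
  continuous (fun t => g t * k t).
Proof. by move=> cg ck t; apply: continuousM; [exact: cg|exact: ck]. Qed.

Lemma continuous_funmax g k : continuous g -> continuous k ->
  continuous (fun t => Num.max (g t) (k t)).
Proof. by move=> cg ck t; apply: continuous_max; [exact: cg|exact: ck]. Qed.

Lemma continuous_funmin g k : continuous g -> continuous k ->
  continuous (fun t => Num.min (g t) (k t)).
Proof. by move=> cg ck t; apply: continuous_min; [exact: cg|exact: ck]. Qed.

Lemma continuous_funcomp g k : continuous g -> continuous k ->
  continuous (fun t => g (k t)).
Proof. by move=> cg ck t; exact: continuous_comp (ck t) (cg (k t)). Qed.

Lemma continuous_funid : continuous (fun t : R => t).
Proof. by move=> t; exact: cvg_id. Qed.

Lemma continuous_funcst c : continuous (fun _ : R => c).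
Proof. by move=> t; exact: cvg_cst. Qed.

Lemma continuous_integrable g a b : continuous g ->
  mu.-integrable `[a, b] (EFin \o g).
Proof.
move=> cg; apply: continuous_compact_integrable; first exact: segment_compact.
by apply: continuous_subspaceT.
Qed.

(* An antiderivative of [g] on the whole line: one of the two integrals is over
   an empty or trivial interval. *)
Definition prim g t : R :=
  Rintegral mu `[0, t] g - Rintegral mu `[t, 0] g.

Lemma Rintegral_cat g a b c : continuous g -> a <= b -> b <= c ->
  Rintegral mu `[a, c] g = Rintegral mu `[a, b] g + Rintegral mu `[b, c] g.
Proof.
move=> cg ab bc.
have := @Rintegral_itvB R g (BLeft a) (BRight c) b (continuous_integrable a c cg).
rewrite !bnd_simp => /(_ ab bc).
rewrite Rintegral_itv_obnd_cbnd; last first.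
  apply: integrableS (continuous_integrable b c cg) => //.
  by apply: subset_itvr; rewrite bnd_simp.
by move=> <-; rewrite addrC subrK.
Qed.

Lemma Rintegral_prim g a b : continuous g -> a <= b ->
  Rintegral mu `[a, b] g = prim g b - prim g a.
Proof.
move=> cg ab.
have null c d : d < c -> Rintegral mu `[c, d] g = 0.
  by move=> dc; rewrite set_itv_ge ?Rintegral_set0// bnd_simp -ltNge.
have nul0 : Rintegral mu `[0, 0] g = 0 by rewrite set_itv1 Rintegral_set1.
rewrite /prim; case: (ltgtP a 0) => a0; case: (ltgtP b 0) => b0.
- by rewrite (null _ _ a0) (null _ _ b0) (@Rintegral_cat _ a b 0)// ?(ltW b0)//; ring.
- by rewrite (null _ _ a0) (null _ _ b0) (@Rintegral_cat _ a 0 b)// ?ltW//; ring.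
- by rewrite b0 (null _ _ a0) nul0; ring.
- by have := lt_le_trans a0 ab; rewrite ltNge (ltW b0).
- by rewrite (null _ _ a0) (null _ _ b0) (@Rintegral_cat _ 0 a b)// ?ltW//; ring.
- by move: ab; rewrite b0 leNgt a0.
- by move: ab; rewrite a0 leNgt b0.
- by rewrite a0 (null _ _ b0) nul0; ring.
- by rewrite a0 b0 nul0; ring.
Qed.

Lemma prim0 g : prim g 0 = 0.
Proof. by rewrite /prim subrr. Qed.

Lemma primE g t : continuous g -> 0 <= t -> prim g t = Rintegral mu `[0, t] g.
Proof. by move=> cg t0; rewrite Rintegral_prim// prim0 subr0. Qed.

(** The fundamental theorem of calculus is applied from the base point [t - 1], so that [t] is
    interior; near [t] the function [prim g] differs from that integral by a constant. *)
Lemma is_derive_prim g t : continuous g -> is_derive t 1 (prim g) (g t).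
Proof.
move=> cg.
have tt : t < t + 1 by rewrite ltrDl.
have tt' : t - 1 < t by rewrite ltrBlDr ltrDl.
have [d e] := @continuous_FTC1_closed R g (t - 1) t (t + 1) tt
  (continuous_integrable _ _ cg) tt' (cg t).
apply: (@near_eq_is_derive _ _ _
  (cst (prim g (t - 1)) + (fun s => Rintegral mu `[t - 1, s] g))).
- near=> s; rewrite fctE/= Rintegral_prim//; first by rewrite addrC subrK.
  by apply: ltW; near: s; exact: lt_nbhsr.
- rewrite -[g t]add0r; apply: is_deriveD.
  by rewrite -e derive1E; exact: derivableP.
Unshelve. all: by end_near. Qed.

Lemma continuous_prim g : continuous g -> continuous (prim g).
Proof. by move=> cg t; apply: is_derive_continuous; exact: is_derive_prim. Qed.

Lemma Rintegral_ge (m : R) g a b : a <= b -> continuous g ->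
  (forall t, a < t < b -> m <= g t) -> m * (b - a) <= Rintegral mu `[a, b] g.
Proof.
move=> ab cg mg; rewrite Rintegral_prim//; apply: (@derive_ge _ _ g) => //.
- by apply/continuous_subspaceT/continuous_prim.
- by move=> t _; exact: is_derive_prim.
Qed.

Lemma Rintegral_le (m : R) g a b : a <= b -> continuous g ->
  (forall t, a < t < b -> g t <= m) -> Rintegral mu `[a, b] g <= m * (b - a).
Proof.
move=> ab cg mg; rewrite Rintegral_prim//; apply: (@derive_le _ _ g) => //.
- by apply/continuous_subspaceT/continuous_prim.
- by move=> t _; exact: is_derive_prim.
Qed.

Lemma ler_Rintegral g k a b : continuous g -> continuous k ->
  (forall t, a <= t <= b -> g t <= k t) ->
  Rintegral mu `[a, b] g <= Rintegral mu `[a, b] k.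
Proof.
move=> cg ck gk; apply: le_Rintegral => //; try exact: continuous_integrable.
Qed.

Lemma normr_Rintegral_le (m : R) g a b : a <= b -> continuous g ->
  (forall t, a < t < b -> `|g t| <= m) -> `|Rintegral mu `[a, b] g| <= m * (b - a).
Proof.
move=> ab cg mg; rewrite ler_norml Rintegral_le// ?andbT.
  by rewrite -mulNr Rintegral_ge// => t /mg; rewrite ler_norml => /andP[].
by move=> t /mg; rewrite ler_norml => /andP[].
Qed.

Lemma Rintegral_subC g k a b : continuous g -> continuous k ->
  Rintegral mu `[a, b] g - Rintegral mu `[a, b] k =
  Rintegral mu `[a, b] (fun t => g t - k t).
Proof. by move=> cg ck; rewrite -RintegralB//; exact: continuous_integrable. Qed.

(** The hypothesis is local but joint in the point and the index, so compactness of the segment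
    makes the convergence uniform. *)
Lemma cvg_Rintegral (I : Type) (F : set_system I) (FF : Filter F)
    (k : I -> R -> R) g a b : a <= b ->
  (forall i, continuous (k i)) -> continuous g ->
  (forall t, a <= t <= b -> forall e, 0 < e ->
     \forall s \near t & i \near F, `|k i s - g s| <= e) ->
  Rintegral mu `[a, b] (k i) @[i --> F] --> Rintegral mu `[a, b] g.
Proof.
move=> ab ck cg kg; apply/cvgrPdist_le => e e0.
(* Adding 1 to the length keeps the divisor positive when [a = b]. *)
have d0 : 0 < e / (b - a + 1).
  by rewrite divr_gt0// ltr_wpDl// subr_ge0.
have /compact_near_coveringP := @segment_compact R a b.
move=> /(_ I F (fun i s => `|k i s - g s| <= e / (b - a + 1)) FF) H.
apply: filterS (H _) => [i /= ki|t]; last first.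
  by rewrite /= in_itv/= => tab; exact: kg.

rewrite distrC Rintegral_subC//.
apply: (@le_trans _ _ (e / (b - a + 1) * (b - a))).
  apply: normr_Rintegral_le => //.
    exact: continuous_funB.
  by move=> t /andP[at_ tb]; apply: ki; rewrite /= in_itv/= !ltW.
rewrite mulrAC ler_pdivrMr ?ltr_wpDl ?subr_ge0//.
by rewrite ler_wpM2l ?ltW// ltrDl.
Qed.

End Calculus.

(** * Convolution with a continuous kernel *)

Section Convolution.
Variable R : realType.
Notation mu := (@lebesgue_measure R).
Implicit Types (g w : R -> R).

Definition conv w g (t : R) : R :=
  Rintegral mu `[0, t] (fun s => w (t - s) * g s).

Lemma continuous_conv_integrand w g (t : R) : continuous w -> continuous g ->
  continuous (fun s => w (t - s) * g s).
Proof.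
move=> cw cg; apply: continuous_funM => //; apply: continuous_funcomp => //.
by apply: continuous_funB; [exact: continuous_funcst|exact: continuous_funid].
Qed.

Lemma conv_ge0 w g (t : R) : (forall s, 0 <= w s) ->
  (forall s, 0 <= s <= t -> 0 <= g s) -> 0 <= conv w g t.
Proof.
move=> w0 g0; apply: Rintegral_ge0 => s; rewrite /= in_itv/= => st.
by rewrite mulr_ge0// g0.
Qed.

Lemma eq_conv w g1 g2 (t : R) : (forall s, 0 <= s <= t -> g1 s = g2 s) ->
  conv w g1 t = conv w g2 t.
Proof.
move=> g12; apply: eq_Rintegral => s; rewrite inE/= in_itv/= => st.
by rewrite g12.
Qed.

Lemma ler_conv_sub w g1 g2 (M e t : R) : continuous w -> continuous g1 ->
  continuous g2 -> 0 <= t ->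
  (forall s, 0 <= s <= t -> `|w s| <= M) ->
  (forall s, 0 <= s <= t -> `|g1 s - g2 s| <= e) ->
  `|conv w g1 t - conv w g2 t| <= M * e * t.
Proof.
move=> cw cg1 cg2 t0 wM ge.
rewrite /conv Rintegral_subC; [|exact: continuous_conv_integrand..].
rewrite -[t in leRHS]subr0.
apply: normr_Rintegral_le => //.
  by apply: continuous_funB; apply: continuous_conv_integrand.
move=> s /andP[s0 st]; rewrite -mulrBr normrM ler_pM//.
  by apply: wM; rewrite subr_ge0 (ltW st) lerBlDr lerDl ltW.
by apply: ge; rewrite !ltW.
Qed.

Lemma conv_normr_le w g (M B t : R) : continuous w -> continuous g -> 0 <= t ->
  (forall s, 0 <= s <= t -> `|w s| <= M) ->
  (forall s, 0 <= s <= t -> `|g s| <= B) -> `|conv w g t| <= M * B * t.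
Proof.
move=> cw cg t0 wM gB.
have -> : conv w g t = conv w g t - conv w (cst 0) t.
  rewrite [X in _ - X](_ : _ = 0) ?subr0// /conv.
  under eq_Rintegral do rewrite mulr0.
  by rewrite Rintegral_cst// mul0r.
apply: ler_conv_sub => //; first exact: continuous_funcst.
by move=> s st; rewrite subr0 gB.
Qed.

(** The contribution of [[0, a]] is nonnegative and dropped; on [[a, t]] the lag [t - s] is at most
    [t - a], where the kernel is at least [m]. *)
Lemma conv_ge w g (m a t : R) : continuous w -> continuous g -> 0 <= a -> a <= t ->
  (forall s, 0 <= w s) -> (forall s, 0 <= g s) ->
  (forall s, 0 <= s <= t - a -> m <= w s) ->
  m * Rintegral mu `[a, t] g <= conv w g t.
Proof.
move=> cw cg a0 at_ w0 g0 mw.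
rewrite /conv (@Rintegral_cat _ _ 0 a t)//; last exact: continuous_conv_integrand.
rewrite -[leLHS]add0r lerD//.
  by apply: Rintegral_ge0 => s _; rewrite mulr_ge0.
rewrite -RintegralZl//; last exact: continuous_integrable.
apply: ler_Rintegral.
- by apply: continuous_funM => //; exact: continuous_funcst.
- exact: continuous_conv_integrand.
- move=> s /andP[as_ st]; rewrite ler_wpM2r// mw//.
  by rewrite subr_ge0 st lerB.
Qed.

(* Subtracting [w 0] removes the jump of the truncated kernel at the moving
   endpoint of the integration interval. *)
Lemma convE w g (t b : R) : continuous w -> continuous g -> 0 <= t -> t <= b ->
  conv w g t = w 0 * prim g t +
    Rintegral mu `[0, b] (fun s => (w (Num.max (t - s) 0) - w 0) * g s).
Proof.
move=> cw cg t0 tb.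
set k := fun s => (w (Num.max (t - s) 0) - w 0) * g s.
have ck : continuous k.
  have cm : continuous (fun u : R => w (Num.max u 0) - w 0).
    apply: continuous_funB; last exact: continuous_funcst.
    apply: continuous_funcomp => //.
    by apply: continuous_funmax; [exact: continuous_funid|exact: continuous_funcst].
  exact: continuous_conv_integrand cm cg.
rewrite (@Rintegral_cat _ k 0 t b)// (_ : Rintegral mu `[t, b] k = 0); last first.
  transitivity (Rintegral mu `[t, b] (fun=> 0)); last by rewrite Rintegral_cst// mul0r.
  apply: eq_Rintegral => s; rewrite inE/= in_itv/= => /andP[ts _].
  by rewrite /k max_r ?subrr ?mul0r// subr_le0.
rewrite addr0 primE// -RintegralZl//; last exact: continuous_integrable.
rewrite -RintegralD//; last 2 first.
  apply: continuous_integrable.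
  by apply: continuous_funM => //; exact: continuous_funcst.
  exact: continuous_integrable.
apply: eq_Rintegral => s; rewrite inE/= in_itv/= => /andP[_ st].
by rewrite /k max_l ?subr_ge0//; ring.
Qed.

(** By [convE] the interval of integration can be fixed, and what remains is continuity of an
    integral with respect to a parameter. *)
Lemma continuous_conv w g : continuous w -> continuous g ->
  continuous (fun t : R => conv w g (Num.max t 0)).
Proof.
move=> cw cg t.
pose v (u : R) := w (Num.max u 0) - w 0.
have cv : continuous v.
  apply: continuous_funB; last exact: continuous_funcst.
  apply: continuous_funcomp => //.
  by apply: continuous_funmax; [exact: continuous_funid|exact: continuous_funcst].
have cmax0 : continuous (fun u : R => Num.max u 0).
  by apply: continuous_funmax; [exact: continuous_funid|exact: continuous_funcst].
(* The margin 1 makes a single interval [[0, b]] serve all times near [t]. *)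
pose b := Num.max t 0 + 1.
pose K r := w 0 * prim g r + Rintegral mu `[0, b] (fun s => v (r - s) * g s).
have cK : continuous K.
  apply: continuous_funD => [|r].
    apply: continuous_funM; first exact: continuous_funcst.
    exact: continuous_prim.
  apply: cvg_Rintegral.
  - by rewrite /b addr_ge0// le_max lexx orbT.
  - by move=> i; exact: continuous_conv_integrand.
  - exact: continuous_conv_integrand.
  move=> s _ e e0.
  have : (v (z.2 - z.1) * g z.1 - v (r - z.1) * g z.1) @[z --> (s, r)] --> (0 : R).
    rewrite -(subrr (v (r - s) * g s)).
    have c1 : z.1 @[z --> (s, r)] --> s by exact: cvg_fst.
    have c2 : z.2 @[z --> (s, r)] --> r by exact: cvg_snd.
    have c3 : g z.1 @[z --> (s, r)] --> g s by apply: continuous_cvg; [exact: cg|].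
    apply: cvgB; apply: cvgM => //; apply: continuous_cvg; try exact: cv.
      exact: cvgB.
    by apply: cvgB => //; exact: cvg_cst.
  move=> /cvgrPdist_le /(_ e e0).
  by apply: filterS => -[s' r'] /=; rewrite sub0r normrN.
have : K (Num.max r 0) @[r --> t] --> conv w g (Num.max t 0).
  rewrite [X in _ --> X](_ : _ = K (Num.max t 0)); last first.
    by rewrite (@convE _ _ _ b)// ?le_max ?lexx ?orbT// /b lerDl.
  exact: (continuous_funcomp cK cmax0).
apply: cvg_trans; apply: near_eq_cvg; near=> r.
rewrite /= (@convE _ _ _ b)// ?le_max ?lexx ?orbT//.
rewrite ge_max; apply/andP; split.
  near: r; apply: lt_le_nbhsl.
  by rewrite /b ltr_pwDr// le_max lexx.
by rewrite /b addr_ge0// le_max lexx orbT.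
Unshelve. all: by end_near. Qed.

End Convolution.

(** * Peano existence for the Volterra equation *)

Section Peano.
Variable R : realType.
Notation mu := (@lebesgue_measure R).

Lemma segment_bounded (g : R -> R) (b : R) : 0 <= b -> continuous g ->
  exists2 M, 0 <= M & forall s, 0 <= s <= b -> `|g s| <= M.
Proof.
move=> b0 cg.
have [|c _ cM] := @EVT_max R (fun s => `|g s|) 0 b b0.
  apply: continuous_subspaceT => s; apply: cvg_norm; exact: cg.
by exists `|g c| => // s sb; apply: cM; rewrite in_itv.
Qed.

(** The image of an ultrafilter is an ultrafilter, and on a compact segment every ultrafilter
    converges. This takes the place of extracting subsequences. *)
Lemma ultra_cvg (T : Type) (U : set_system T) (u : T -> R) (M : R) : UltraFilter U ->
  (forall n, `|u n| <= M) -> exists l : R, u n @[n --> U] --> l.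
Proof.
move=> UU uM.
have UF : UltraFilter (fmap u U).
  split; first exact: fmap_proper_filter.
  move=> G PG sub; rewrite predeqE => A; split; last exact: sub.
  move=> GA; have [//|UA] := in_ultra_setVsetC (u @^-1` A) UU.
  have GA' : G (~` A) by exact: sub.
  by have [s []] := filter_ex (filterI GA GA').
have : compact (`[(- M), M] : set R) by exact: segment_compact.
rewrite compact_ultra => /(_ _ UF) H.
have [|l [_ ul]] := H; last by exists l.
by apply: (@filterE _ U) => n /=; rewrite in_itv/= -ler_norml.
Qed.

Lemma norm_min_sub (s t s' t' d : R) : `|s - s'| <= d -> `|t - t'| <= d ->
  `|Num.min s t - Num.min s' t'| <= d.
Proof.
rewrite !ler_norml => /andP[? ?] /andP[? ?].
by rewrite !minElt; case: ifPn; case: ifPn; rewrite -?leNgt => ? ?; lra.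
Qed.

Lemma norm_max_sub (s t s' t' d : R) : `|s - s'| <= d -> `|t - t'| <= d ->
  `|Num.max s t - Num.max s' t'| <= d.
Proof.
rewrite !ler_norml => /andP[? ?] /andP[? ?].
by rewrite !maxElt; case: ifPn; case: ifPn; rewrite -?leNgt => ? ?; lra.
Qed.

Lemma lipschitz_continuous (g : R -> R) (L : R) :
  (forall s t, `|g s - g t| <= L * `|s - t|) -> continuous g.
Proof.
move=> gL t; apply/cvgrPdist_le => e e0.
have d0 : 0 < e / (`|L| + 1) by rewrite divr_gt0// ltr_wpDl.
have /cvgrPdist_le /(_ _ d0) : s @[s --> t] --> t by exact: cvg_id.
apply: filterS => s /= ts; rewrite (le_trans (gL _ _))//.
apply: (@le_trans _ _ ((`|L| + 1) * (e / (`|L| + 1)))).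
  apply: (le_trans (ler_norm _)); rewrite normrM normr_id.
  by apply: ler_pM => //; rewrite lerDl.
by rewrite mulrC divfK// gt_eqF// ltr_wpDl.
Qed.

Variables w h F : R -> R.
Hypotheses (cw : continuous w) (ch : continuous h) (cF : continuous F).

(** Right-hand side of the equation along [y]. Holding the convolution at its value at time 0 for
    [r < 0] makes the rate continuous on the whole line. *)
Definition rate (y : R -> R) (r : R) : R :=
  h r + conv w (fun s => F (y s)) (Num.max r 0).

Lemma continuous_rate (y : R -> R) : continuous y -> continuous (rate y).
Proof.
move=> cy; apply: continuous_funD => //; apply: continuous_conv => //.
exact: continuous_funcomp.
Qed.

Variables (psi B : R).
Hypothesis (FB : forall u, `|F u| <= B).

Definition picard (y : R -> R) (t : R) : R := psi + prim (rate y) t.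

(** Causality: the history after [t] does not enter. This is what leaves a solution on [[0, a]]
    untouched while it is continued. *)
Lemma eq_picard (y1 y2 : R -> R) (t : R) : continuous y1 -> continuous y2 -> 0 <= t ->
  (forall s, 0 <= s <= t -> y1 s = y2 s) -> picard y1 t = picard y2 t.
Proof.
move=> c1 c2 t0 y12; congr (_ + _).
rewrite (primE (continuous_rate c1) t0) (primE (continuous_rate c2) t0).
apply: eq_Rintegral => r; rewrite inE/= in_itv/= => /andP[r0 rt].
congr (_ + _); apply: eq_conv => s; rewrite max_l// => /andP[s0 sr].
by rewrite y12// s0 (le_trans sr).
Qed.

(** The constant is uniform in [y] because [F] is bounded by [B]; it makes the approximate solutions
    equi-Lipschitz. *)
Lemma picard_lipschitz (b : R) : 0 <= b -> exists L, 0 <= L /\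
  forall y, continuous y -> forall s t, 0 <= s <= b -> 0 <= t <= b ->
  `|picard y s - picard y t| <= L * `|s - t|.
Proof.
move=> b0; have [Mw Mw0 wM] := segment_bounded b0 cw.
have [Mh Mh0 hM] := segment_bounded b0 ch.
have B0 : 0 <= B by exact: le_trans (FB 0).
exists (Mh + Mw * B * b); split; first by rewrite addr_ge0// !mulr_ge0.
move=> y cy s t; wlog st : s t / t <= s.
  move=> H sb tb; have [ts|st] := leP t s; first exact: H.
  by rewrite distrC (distrC s) H// ltW.
move=> /andP[s0 sb] /andP[t0 tb].
have cr := continuous_rate cy.
rewrite (_ : picard y s - picard y t = prim (rate y) s - prim (rate y) t); last first.
  by rewrite /picard opprD addrACA subrr add0r.
rewrite -Rintegral_prim// (ger0_norm (_ : 0 <= s - t)) ?subr_ge0//.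
apply: normr_Rintegral_le => // r /andP[tr rs].
have r0 : 0 <= r by rewrite (le_trans t0)// ltW.
have rb : r <= b by rewrite (le_trans _ sb)// ltW.
rewrite /rate max_l// (le_trans (ler_normD _ _))// lerD//.
  by apply: hM; rewrite r0.
apply: (@le_trans _ _ (Mw * B * r)).
  apply: conv_normr_le => //; first exact: continuous_funcomp.
  by move=> u /andP[u0 ur]; apply: wM; rewrite u0 (le_trans ur).
by rewrite ler_wpM2l// mulr_ge0.
Qed.

(** * Approximate solutions by a delayed equation *)

Section delayed.
Variables (a b e : R) (x : R -> R).
Hypotheses (a0 : 0 <= a) (ab : a <= b) (e0 : 0 < e) (cx : continuous x).
Hypothesis xsol : forall t, 0 <= t <= a -> picard x t = x t.

Let clamp (t : R) := Num.max 0 (Num.min t b).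
(** On [[0, a]] the delay is inactive; on [[a, b]] the delayed time is [Num.max (t - e) a], so there
    the right-hand side looks back by [e] but never before [a]. *)
Let delay (t : R) := Num.min (clamp t) (Num.max (clamp t - e) a).

Let clampE t : 0 <= t <= b -> clamp t = t.
Proof. by move=> /andP[t0 tb]; rewrite /clamp min_l// max_r. Qed.

Let delay_itv t : 0 <= delay t <= b.
Proof.
have b0 := le_trans a0 ab.
have /andP[c0 cb] : 0 <= clamp t <= b.
  by rewrite /clamp le_max lexx/= ge_max b0 ge_min lexx orbT.
by rewrite /delay le_min ge_min cb c0 le_max a0 orbT.
Qed.

Let delay_lip s t : `|delay s - delay t| <= `|s - t|.
Proof.
have cl : `|clamp s - clamp t| <= `|s - t|.
  apply: norm_max_sub; first by rewrite subrr normr0.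
  by apply: norm_min_sub; rewrite // subrr normr0.
apply: norm_min_sub => //; apply: norm_max_sub; last by rewrite subrr normr0.
by rewrite (_ : _ - _ = clamp s - clamp t)//; ring.
Qed.

Let delay_left t : 0 <= t <= a -> delay t = t.
Proof.
move=> /andP[t0 ta]; rewrite /delay clampE ?t0 ?(le_trans ta)//.
by rewrite min_l// le_max ta orbT.
Qed.

Let delay_close t : 0 <= t <= b -> `|delay t - t| <= e.
Proof.
move=> tb; rewrite /delay clampE//; move: tb => /andP[t0 tb].
rewrite minElt maxElt; do 2 case: ifPn; rewrite -?leNgt ler_norml => ? ?;
  have := ltW e0; lra.
Qed.

Let iter_y := fix iter_y (k : nat) : R -> R :=
  if k is k'.+1 then (fun t => picard (iter_y k') (delay t)) else x.

(** Each iteration settles the values on one more interval of length [e], so after finitely many the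
    delayed equation holds exactly on [[0, b]]. The delay shifts time by at most [e], which costs at
    most [L * e] in the original equation. *)
Lemma delayed_solution (L : R) :
  (forall y, continuous y -> forall s t, 0 <= s <= b -> 0 <= t <= b ->
    `|picard y s - picard y t| <= L * `|s - t|) -> 0 <= L ->
  exists y, [/\ forall s t, `|y s - y t| <= L * `|s - t|,
    forall t, 0 <= t <= a -> y t = x t &
    forall t, 0 <= t <= b -> `|y t - picard y t| <= L * e].
Proof.
move=> pL L0.
have ilip k : continuous (iter_y k) ->
    forall s t, `|iter_y k.+1 s - iter_y k.+1 t| <= L * `|s - t|.
  move=> cy s t /=; rewrite (le_trans (pL _ cy _ _ _ _))//.
  by rewrite ler_wpM2l.
have cy k : continuous (iter_y k).
  by elim: k => // k IH; apply: lipschitz_continuous (ilip _ IH).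
have yx k t : 0 <= t <= a -> iter_y k t = x t.
  elim: k t => [//|k IH] t ta; rewrite /= (delay_left ta) -[RHS](xsol ta).
  move: ta => /andP[t0 ta]; apply: eq_picard => // s /andP[s0 st].
  by rewrite IH// s0 (le_trans st).
(* After [k] iterations the values up to [a + e * k] no longer change, since the delayed time of
   such a point is at most [a + e * (k - 1)] or at most [a]. *)
have stable k t : 0 <= t <= b -> t <= a + e * k%:R -> iter_y k.+1 t = iter_y k t.
  elim: k t => [|k IH] t /andP[t0 tb].
    by rewrite mulr0 addr0 => ta; rewrite !yx// t0.
  move=> tk; have /andP[d0 db] := @delay_itv t.
  apply: (@eq_picard (iter_y k.+1) (iter_y k)) => // s /andP[s0 sd]; apply: IH.
    by rewrite s0 (le_trans sd).
  apply: (le_trans sd); rewrite /delay clampE ?t0// ge_min ge_max.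
  apply/orP; right; apply/andP; split; last by rewrite lerDl mulr_ge0// ltW.
  by move: tk; rewrite -natr1 mulrDr mulr1 addrA lerBlDr.
have [k bk] : exists k : nat, b <= a + e * k%:R.
  exists (Num.truncn ((b - a) / e)).+1.
  rewrite -lerBlDl mulrC -ler_pdivrMr//.
  by rewrite ltW// truncnS_gt.
(* The index is a successor because the initial iterate [x] is merely continuous, while all later
   ones are Lipschitz. *)
exists (iter_y k.+1); split.
- by apply: ilip.
- by move=> t ta; rewrite yx.
move=> t /andP[t0 tb].
have /andP[d0 db] := @delay_itv t.
rewrite [X in `|X - _|]/= (@eq_picard (iter_y k) (iter_y k.+1))//; last first.
  move=> s /andP[s0 sd]; rewrite stable ?s0 ?(le_trans sd)//.
  exact: (le_trans db).
apply: (le_trans (pL _ (cy k.+1) _ _ (@delay_itv t) _)); first by rewrite t0.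
by rewrite ler_wpM2l// delay_close// t0.
Qed.

End delayed.

(** Delayed solutions with delay [n.+1%:R^-1] converge pointwise along an ultrafilter, and the limit
    inherits their Lipschitz bound. Compactness upgrades this to uniform convergence of [F (Y n s)],
    which allows passing to the limit in the integral equation. *)
Lemma peano (a b : R) (x : R -> R) : 0 <= a -> a <= b -> continuous x ->
  (forall t, 0 <= t <= a -> picard x t = x t) ->
  exists y, [/\ continuous y, forall t, 0 <= t <= a -> y t = x t &
    forall t, 0 <= t <= b -> picard y t = y t].
Proof.
move=> a0 ab cx xsol; have b0 := le_trans a0 ab.
have [L [L0 pL]] := picard_lipschitz b0.
have in0 (n : nat) : 0 < (n.+1%:R^-1 : R) by rewrite invr_gt0.
have /choice[Y YP] (n : nat) := delayed_solution a0 ab (in0 n) cx xsol pL L0.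
have cY n : continuous (Y n).
  by case: (YP n) => YL _ _; apply: lipschitz_continuous YL.
(* Refining the filter of cofinite sets ensures that the delays tend to 0 along [U]. *)
have [U [UU oU]] := @ultraFilterLemma _ _ eventually_filter.
have PU : ProperFilter U := @ultra_proper _ _ UU.
have /choice[y Yy] (t : R) : exists l : R, Y n t @[n --> U] --> l.
  apply: (@ultra_cvg _ _ _ (`|x 0| + L * `|t|)) => n.
  have [YL Yx _] := YP n.
  rewrite -[Y n t](subrK (Y n 0)) (le_trans (ler_normD _ _))// addrC lerD//.
    by rewrite Yx// lexx.
  by rewrite (le_trans (YL _ _))// subr0.
have yL s t : `|y s - y t| <= L * `|s - t|.
  have H : `|Y n s - Y n t| @[n --> U] --> `|y s - y t|.
    by apply: cvg_norm; apply: cvgB; exact: Yy.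
  apply: (cvgr_to_le H); apply: filterE => n.
  by have [YL _ _] := YP n; exact: YL.
have cy := lipschitz_continuous yL.
exists y; split => //.
  move=> t ta; apply: (@cvg_unique _ (@Rhausdorff R) _ _ _ _ (Yy t)).
  by apply: cvg_near_cst; apply: filterE => n; have [_ Yx _] := YP n; exact: Yx.
move=> t tb; move: (tb) => /andP[t0 tb'].
(* Near each [s] the common Lipschitz constant controls the change of the point and the limit at [s]
   controls the index, so the convergence is joint and compactness applies. *)
have unif (e : R) : 0 < e ->
    \forall n \near U, forall s, 0 <= s <= b -> `|F (Y n s) - F (y s)| <= e.
  move=> e0.
  have /compact_near_coveringP := @segment_compact R 0 b.
  move=> /(_ nat U (fun n s => `|F (Y n s) - F (y s)| <= e) _) H.
  apply: filterS (H _) => [n nP s sb|s _]; first by apply: nP; rewrite /= in_itv.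
  have YsU : Y z.2 z.1 @[z --> (s, U)] --> y s.
    apply/cvgrPdist_le => d d0.
    have d2 : 0 < d / 2 by rewrite divr_gt0.
    have dL : 0 < d / 2 / (L + 1) by rewrite divr_gt0// ltr_wpDl.
    have /cvgrPdist_le /(_ _ d2) HU := Yy s.
    have /cvgrPdist_le /(_ _ dL) Hs : r @[r --> s] --> s by exact: cvg_id.
    exists ([set r | `|s - r| <= d / 2 / (L + 1)], [set n | `|y s - Y n s| <= d / 2]) => //.
    move=> [r n] /= [sr yn].
    have [YL _ _] := YP n.
    rewrite (_ : y s - Y n r = (y s - Y n s) + (Y n s - Y n r)); last by ring.
    rewrite (le_trans (ler_normD _ _))// [leRHS]splitr lerD//.
    rewrite (le_trans (YL _ _))//.
    apply: (@le_trans _ _ ((L + 1) * (d / 2 / (L + 1)))).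
      by apply: ler_pM => //; rewrite lerDl.
    by rewrite mulrC divfK// gt_eqF// ltr_wpDl.
  have FYs : F (Y z.2 z.1) @[z --> (s, U)] --> F (y s).
    by apply: continuous_cvg YsU; exact: cF.
  have Fys : F (y z.1) @[z --> (s, U)] --> F (y s).
    apply: (@cvg_comp _ _ _ fst (fun r => F (y r)) _ (nbhs s)); first exact: cvg_fst.
    exact: (continuous_funcomp cF cy).
  have : F (Y z.2 z.1) - F (y z.1) @[z --> (s, U)] --> F (y s) - F (y s).
    exact: cvgB.
  rewrite subrr => /cvgrPdist_le /(_ e e0).
  by apply: filterS => -[s' n] /=; rewrite sub0r normrN.
have [Mw Mw0 wM] := segment_bounded b0 cw.
have pY : picard (Y n) t @[n --> U] --> picard y t.
  apply/cvgrPdist_le => e e0.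
  have K0 : 0 < Mw * b * b + 1 by rewrite ltr_wpDl// !mulr_ge0.
  have d0 : 0 < e / (Mw * b * b + 1) by rewrite divr_gt0.
  apply: filterS (unif _ d0) => n nP.
  have cr1 := continuous_rate cy; have cr2 := continuous_rate (cY n).
  rewrite (_ : picard y t - picard (Y n) t = prim (rate y) t - prim (rate (Y n)) t); last first.
    by rewrite /picard opprD addrACA subrr add0r.
  rewrite !primE// Rintegral_subC//.
  apply: (@le_trans _ _ (Mw * (e / (Mw * b * b + 1)) * b * (t - 0))).
    apply: normr_Rintegral_le => //; first exact: continuous_funB.
    move=> r /andP[r0 rt]; rewrite /rate max_l ?(ltW r0)//.
    have rb : r <= b by rewrite (le_trans (ltW rt)).
    rewrite (_ : _ - _ = conv w (fun s => F (y s)) r - conv w (fun s => F (Y n s)) r); last by ring.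
    apply: (@le_trans _ _ (Mw * (e / (Mw * b * b + 1)) * r)).
      apply: ler_conv_sub => //; [exact: continuous_funcomp..|exact: ltW| |].
        by move=> s /andP[s0 sr]; apply: wM; rewrite s0 (le_trans sr).
      by move=> s /andP[s0 sr]; rewrite distrC; apply: nP; rewrite s0 (le_trans sr).
    by rewrite ler_wpM2l// mulr_ge0// ltW.
  rewrite subr0.
  apply: (@le_trans _ _ (Mw * (e / (Mw * b * b + 1)) * b * b)).
    by apply: ler_wpM2l => //; do 2 apply: mulr_ge0 => //; exact: ltW.
  rewrite (_ : _ * b = e * ((Mw * b * b) / (Mw * b * b + 1))); last by ring.
  by rewrite ger_pMr// ler_pdivrMr// mul1r lerDl.
(* The defect of [Y n] in the integral equation is at most [L / n.+1%:R]. *)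
have H0 : (Y n t - picard (Y n) t) @[n --> U] --> (0 : R).
  apply/cvgrPdist_le => e e0.
  have d0 : 0 < e / (L + 1) by rewrite divr_gt0// ltr_wpDl.
  have : \forall n \near U, n.+1%:R^-1 < e / (L + 1).
    by apply: oU; exact: (near_infty_natSinv_lt (PosNum d0)).
  apply: filterS => n ne; rewrite sub0r normrN.
  have [_ _ YpY] := YP n; rewrite (le_trans (YpY _ tb))//.
  apply: (@le_trans _ _ ((L + 1) * (e / (L + 1)))).
    by apply: ler_pM => //; rewrite ?lerDl// ltW.
  by rewrite mulrC divfK// gt_eqF// ltr_wpDl.
have H1 : (Y n t - picard (Y n) t) @[n --> U] --> y t - picard y t.
  by apply: cvgB => //; exact: Yy.
by apply/esym/subr0_eq; apply: (cvg_unique (@Rhausdorff R) H1 H0).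
Qed.
End Peano.

(** * The functions Fint and FB *)

Section Integrals_of_f.
Variable R : realType.
Notation mu := (@lebesgue_measure R).
Variable f : R -> R.
Hypotheses (pcf : pos_cont f) (osg : osgood_cond f)
  (fsup : f x / x @[x --> +oo] --> +oo).

Lemma continuous_fmax (v : R) : 0 < v -> continuous (fun u => f (Num.max v u)).
Proof.
move=> v0; case: pcf => cf _.
apply: (continuous_comp_within cf).
  by apply: continuous_funmax; [exact: continuous_funcst|exact: continuous_funid].
by move=> t; rewrite /= in_itv/= andbT lt_max v0.
Qed.

Let mf (u : R) : measurable_fun `]0, u]%classic f.
Proof.
case: pcf => cf _; apply: subspace_continuous_measurable_fun => //.
apply: continuous_subspaceW cf.
by apply: subset_itvl.
Qed.

Let f0 (u s : R) : `]0, u]%classic s -> 0 <= f s.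
Proof. by case: pcf => _ fp; rewrite /= in_itv/= => /andP[s0 _]; rewrite ltW// fp. Qed.

Lemma Rintegral_fmax (v u : R) : 0 < v ->
  Rintegral mu `[v, u] f = Rintegral mu `[v, u] (fun s => f (Num.max v s)).
Proof.
move=> v0; apply: eq_Rintegral => s; rewrite inE/= in_itv/= => /andP[vs _].
by rewrite max_r.
Qed.

(** Continuity says nothing about [f] near 0: there the finiteness comes from the integral
    condition, and beyond [eta] from continuity on a compact segment. *)
Let integrable_f (u : R) : 0 < u -> mu.-integrable `]0, u] (EFin \o f).
Proof.
move=> u0; have [eta [eta0 [feta _]]] := osg.
have absE (A : set R) : A `<=` `]0, u]%classic ->
    (\int[mu]_(s in A) `|(EFin \o f) s| = \int[mu]_(s in A) (f s)%:E)%E.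
  move=> Au; apply: eq_integral => s; rewrite inE => /Au /f0 fs.
  by rewrite /= ger0_norm.
have [ue|eu] := leP u eta.
  apply/integrableP; split; first by apply/measurable_EFinP; exact: mf.
  rewrite absE//; apply: le_lt_trans feta; apply: ge0_subset_integral => //.
  - by apply/measurable_EFinP; exact: mf.
  - by move=> s /f0; rewrite lee_fin.
  - exact: subset_itvl.
apply/integrableP; split; first by apply/measurable_EFinP; exact: mf.
have U : `]0, u]%classic = `]0, eta]%classic `|` `]eta, u]%classic :> set R.
  by rewrite -itv_bndbnd_setU// bnd_simp// ltW.
have mU : measurable_fun (`]0, eta]%classic `|` `]eta, u]%classic) f.
  by rewrite -U; exact: mf.
have pU (s : R) : (`]0, eta]%classic `|` `]eta, u]%classic) s -> (0 <= (f s)%:E)%E.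
  by rewrite -U => /f0; rewrite lee_fin.
have dU : [disjoint `]0, eta]%classic & `]eta, u]%classic].
  apply/disj_setPS => s []; rewrite /= !in_itv/= => /andP[_ se] /andP[es _].
  by move: se; rewrite leNgt es.
rewrite absE// U ge0_integral_setU//; last exact/measurable_EFinP.
apply: lte_add_pinfty => //.
rewrite integral_itv_obnd_cbnd; last first.
  apply/measurable_EFinP; apply: (measurable_funS _ _ (@mf u)) => //.
  by apply: subset_itvr; rewrite bnd_simp ltW.
have -> : (\int[mu]_(s in `[eta, u]) (f s)%:E =
           \int[mu]_(s in `[eta, u]) (f (Num.max eta s))%:E)%E.
  by apply: eq_integral => s; rewrite inE/= in_itv/= => /andP[es _]; rewrite max_r.
rewrite -ge0_fin_numE.
  apply: integrable_fin_num => //.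
  by apply: continuous_integrable; exact: continuous_fmax.
apply: integral_ge0 => s _; rewrite lee_fin.
by case: pcf => _ fp; rewrite ltW// fp// lt_max eta0.
Qed.

Lemma FintE (v u : R) : 0 < v -> v <= u ->
  Fint f u = Fint f v + Rintegral mu `[v, u] f.
Proof.
move=> v0 vu; have u0 := lt_le_trans v0 vu.
have := @Rintegral_itvB R f (BRight 0) (BRight u) v (integrable_f u0).
rewrite !bnd_simp => /(_ (ltW v0) vu).
rewrite [RHS]Rintegral_itv_obnd_cbnd; last first.
  by apply: integrableS (integrable_f u0) => //; apply: subset_itvr; rewrite bnd_simp ltW.
by move=> <-; rewrite addrC subrK.
Qed.

Lemma FintE_prim (v u : R) : 0 < v -> v <= u ->
  Fint f u = Fint f v - prim (fun s => f (Num.max v s)) v +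
             prim (fun s => f (Num.max v s)) u.
Proof.
move=> v0 vu; rewrite (FintE v0 vu) Rintegral_fmax// Rintegral_prim//.
  by ring.
exact: continuous_fmax.
Qed.

(** Splitting the integral at [u / 2] keeps away from 0, where [f] need not extend continuously. *)
Lemma is_derive_Fint (u : R) : 0 < u -> is_derive u 1 (Fint f) (f u).
Proof.
move=> u0; have v0 : 0 < u / 2 by rewrite divr_gt0.
have vu : u / 2 < u by rewrite ltr_pdivrMr// ltr_pMr// ltr1n.
apply: (@near_eq_is_derive _ _ _ (cst (Fint f (u / 2) -
    prim (fun s => f (Num.max (u / 2) s)) (u / 2)) +
  prim (fun s => f (Num.max (u / 2) s)))).
  near=> s; rewrite fctE/= -FintE_prim//.
  by apply: ltW; near: s; exact: lt_nbhsr.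
rewrite -[f u]add0r; apply: is_deriveD.
rewrite -[X in f X](@max_r _ _ (u / 2) u) ?(ltW vu)//.
exact: is_derive_prim (continuous_fmax v0).
Unshelve. all: by end_near. Qed.

Lemma continuous_Fint (u : R) : 0 < u -> {for u, continuous (Fint f)}.
Proof. by move=> u0; apply: is_derive_continuous; exact: is_derive_Fint. Qed.

Lemma within_continuous_Fint (a b : R) : 0 < a -> {within `[a, b], continuous (Fint f)}.
Proof.
move=> a0; apply: derivable_within_continuous => u; rewrite in_itv/= => /andP[au _].
by apply: ex_derive; apply: is_derive_Fint; exact: lt_le_trans au.
Qed.

Lemma Fint_ge (m v u : R) : 0 < v -> v <= u ->
  (forall s, v < s < u -> m <= f s) -> m * (u - v) <= Fint f u - Fint f v.
Proof.
move=> v0 vu mf'; apply: (@derive_ge _ _ _ f) => //; first exact: within_continuous_Fint.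
by move=> s /andP[vs _]; apply: is_derive_Fint; exact: lt_trans vs.
Qed.

Lemma Fint_le (m v u : R) : 0 < v -> v <= u ->
  (forall s, v < s < u -> f s <= m) -> Fint f u - Fint f v <= m * (u - v).
Proof.
move=> v0 vu mf'; apply: (@derive_le _ _ _ f) => //; first exact: within_continuous_Fint.
by move=> s /andP[vs _]; apply: is_derive_Fint; exact: lt_trans vs.
Qed.

Lemma Fint_gt0 (u : R) : 0 < u -> 0 < Fint f u.
Proof.
move=> u0; have v0 : 0 < u / 2 by rewrite divr_gt0.
have vu : u / 2 < u by rewrite ltr_pdivrMr// ltr_pMr// ltr1n.
have F0 : 0 <= Fint f (u / 2) by apply: Rintegral_ge0 => s /f0.
apply: (le_lt_trans F0); rewrite -subr_gt0.
have dF s : s \in `](u / 2), u[ -> is_derive s 1 (Fint f) (f s).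
  rewrite in_itv/= => /andP[vs _]; apply: is_derive_Fint; exact: lt_trans vs.
have [c] := MVT vu dF (@within_continuous_Fint _ u v0).
rewrite in_itv/= => /andP[vc _] ->; rewrite mulr_gt0 ?subr_gt0//.
by case: pcf => _ ->//; exact: lt_trans vc.
Qed.

Lemma near_f_ge (A : R) : exists u0, 0 < u0 /\ forall u, u0 <= u -> A * u <= f u.
Proof.
move: fsup => /cvgryPge /(_ A) [M [_ HM]].
exists (Num.max M 0 + 1); split; first by rewrite ltr_wpDl// le_max lexx orbT.
move=> u Mu.
have u0 : 0 < u by apply: lt_le_trans Mu; rewrite ltr_wpDl// le_max lexx orbT.
rewrite -ler_pdivlMr//; apply: HM; apply: lt_le_trans Mu.
by rewrite ltr_pwDr// le_max lexx.
Qed.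

(** Holding the argument at [v] from below makes the integrand of [FB] continuous on the whole line
    when [0 < v], so that [prim] applies. *)
Let G (v u : R) := (Num.sqrt (Fint f (Num.max v u)))^-1.

Let continuous_G v : 0 < v -> continuous (G v).
Proof.
move=> v0 u.
apply: (@continuousV _ _ (fun u => Num.sqrt (Fint f (Num.max v u))) u).
  by rewrite gt_eqF// sqrtr_gt0 Fint_gt0// lt_max v0.
apply: (@continuous_comp _ _ _ (fun u => Fint f (Num.max v u)) Num.sqrt).
  apply: (@continuous_comp _ _ _ (fun u => Num.max v u) (Fint f)).
    by apply: continuous_funmax; [exact: continuous_funcst|exact: continuous_funid].
  by apply: continuous_Fint; rewrite lt_max v0.
exact: sqrt_continuous.
Qed.

(** The primitive is nondecreasing, and bounded by the integral condition, so it converges to its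
    supremum [l]; the fundamental theorem on a half-line then identifies [FB]. *)
Lemma FB_prim (v : R) : 0 < v -> exists l,
  prim (G v) u @[u --> +oo] --> l /\ forall u, v <= u -> FB f u = l - prim (G v) u.
Proof.
move=> v0; have cG := continuous_G v0.
have G0 u : 0 <= G v u by rewrite invr_ge0 sqrtr_ge0.
have nd : {homo prim (G v) : s t / s <= t}.
  move=> s t st; rewrite -subr_ge0 -Rintegral_prim//.
  by apply: Rintegral_ge0 => u _.
have [eta [eta0 [_ int_fin]]] := osg.
pose e := Num.max eta v.
have mG : measurable_fun `[eta, +oo[%classic (fun u => (Num.sqrt (Fint f u))^-1).
  apply: subspace_continuous_measurable_fun => //.
  apply: (@subspace_eq_continuous _ _ _ (G eta)).
    by move=> u; rewrite inE/= in_itv/= andbT => eu; rewrite /from_subspace/= /G max_r.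
  by apply: continuous_subspaceT; exact: continuous_G.
have ub : has_ubound (range (prim (G v))).
  (* Beyond [e = Num.max eta v] the function [G v] is the integrand of the integral condition, so
     the increment of the primitive after [e] is at most that finite integral. *)
  exists (prim (G v) e + fine (\int[mu]_(u in `[eta, +oo[) ((Num.sqrt (Fint f u))^-1)%:E)%E).
  move=> _ [u _ <-].
  apply: (@le_trans _ _ (prim (G v) (Num.max e u))).
    by apply: nd; rewrite le_max lexx orbT.
  have eu : e <= Num.max e u by rewrite le_max lexx.
  rewrite -lerBlDl -(Rintegral_prim cG eu).
  apply: fine_le.
  - by apply: integrable_fin_num => //; exact: continuous_integrable.
  - by rewrite ge0_fin_numE//; apply: integral_ge0 => s _; rewrite lee_fin invr_ge0 sqrtr_ge0.
  have -> : (\int[mu]_(s in `[e, (Num.max e u)]) (G v s)%:E =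
      \int[mu]_(s in `[e, (Num.max e u)]) ((Num.sqrt (Fint f s))^-1)%:E)%E.
    apply: eq_integral => s; rewrite inE/= in_itv/= => /andP[es _].
    by rewrite /G max_r// (le_trans _ es)// /e le_max lexx orbT.
  apply: ge0_subset_integral => //.
  - exact/measurable_EFinP.
  - move=> s; rewrite /= !in_itv/= andbT => /andP[es _].
    by rewrite (le_trans _ es)// /e le_max lexx.
exists (sup (range (prim (G v)))).
have cvl := nondecreasing_cvgr nd ub.
split => // u vu.
rewrite /FB.
have -> : (\int[mu]_(s in `[u, +oo[) ((Num.sqrt (Fint f s))^-1)%:E =
    \int[mu]_(s in `[u, +oo[) (G v s)%:E)%E.
  apply: eq_integral => s; rewrite inE/= in_itv/= andbT => us.
  by rewrite /G max_r// (le_trans vu).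
rewrite (@ge0_continuous_FTC2y _ _ (prim (G v)) _ (sup (range (prim (G v)))))//.
- exact: continuous_subspaceT.
- by move=> s _; apply: ex_derive; exact: is_derive_prim.
- by apply: cvg_at_right_filter; exact: continuous_prim.
- move=> s _; rewrite derive1E; have := is_derive_prim s cG.
  by move=> ?; rewrite derive_val.
Qed.

Lemma is_derive_FB (u : R) : 0 < u ->
  is_derive u 1 (FB f) (- (Num.sqrt (Fint f u))^-1).
Proof.
move=> u0; have v0 : 0 < u / 2 by rewrite divr_gt0.
have vu : u / 2 < u by rewrite ltr_pdivrMr// ltr_pMr// ltr1n.
have [l [_ FBl]] := FB_prim v0.
apply: (@near_eq_is_derive _ _ _ (cst l - prim (G (u / 2)))).
  near=> s; rewrite !fctE/= -FBl//.
  by apply: ltW; near: s; exact: lt_nbhsr.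
rewrite -[X in is_derive _ _ _ X]add0r; apply: is_deriveB.
have := is_derive_prim u (@continuous_G _ v0).
by rewrite /G max_r// ltW.
Unshelve. all: by end_near. Qed.

Lemma FB_ge0 (u : R) : 0 <= FB f u.
Proof.
by apply: fine_ge0; apply: integral_ge0 => s _; rewrite lee_fin invr_ge0 sqrtr_ge0.
Qed.

Lemma FB_cvg0 : FB f u @[u --> +oo] --> 0.
Proof.
have [l [cl FBl]] := @FB_prim 1 ltr01.
have : (l - prim (G 1) u) @[u --> +oo] --> (0 : R).
  by rewrite -(subrr l); apply: cvgB => //; exact: cvg_cst.
apply: cvg_trans; apply: near_eq_cvg; near=> u; rewrite FBl//.
Unshelve. all: by end_near. Qed.

End Integrals_of_f.

(** * Elementary properties of solutions *)

Section Solutions.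
Variable R : realType.
Notation mu := (@lebesgue_measure R).
Variables (f w h : R -> R) (psi : R) (T : \bar R) (x : R -> R).
Hypotheses (pcf : pos_cont f) (cw : continuous w) (w_ge0 : forall s, 0 <= w s)
  (ch : continuous h) (H_ge0 : forall t, 0 <= t -> 0 <= Hint h t)
  (psi0 : 0 < psi) (sol : is_sol f w h psi T x).

(** Clamping time to [[0, b]] yields, for [b] in the domain, a positive function continuous on the
    whole line, to which the results on primitives and convolutions apply. *)
Definition freeze (b t : R) : R := x (Num.max 0 (Num.min t b)).

Lemma freezeE (b t : R) : 0 <= t <= b -> freeze b t = x t.
Proof. by move=> /andP[t0 tb]; rewrite /freeze min_l// max_r. Qed.

Let dom_sub (a b : R) : 0 <= a -> (b%:E < T)%E -> `[a, b]%classic `<=` dom0 T.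
Proof.
move=> a0 bT t; rewrite /= in_itv/= => /andP[at_ tb]; split; first exact: le_trans at_.
by apply: le_lt_trans bT; rewrite lee_fin.
Qed.

Lemma sol_continuous (a b : R) : 0 <= a -> (b%:E < T)%E ->
  {within `[a, b], continuous x}.
Proof.
by move=> a0 bT; case: sol => _ _ cx _ _; apply: continuous_subspaceW cx; exact: dom_sub.
Qed.

Lemma sol_gt0 (t : R) : 0 <= t -> (t%:E < T)%E -> 0 < x t.
Proof. by move=> t0 tT; case: sol => _ _ _ + _; apply; rewrite inE. Qed.

Lemma continuous_freeze (b : R) : 0 <= b -> (b%:E < T)%E -> continuous (freeze b).
Proof.
move=> b0 bT; apply: (continuous_comp_within (@sol_continuous 0 b _ bT)) => //.
  apply: continuous_funmax; first exact: continuous_funcst.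
  by apply: continuous_funmin; [exact: continuous_funid|exact: continuous_funcst].
by move=> t; rewrite /= in_itv/= le_max lexx/= ge_max b0 ge_min lexx orbT.
Qed.

Lemma freeze_gt0 (b t : R) : 0 <= b -> (b%:E < T)%E -> 0 < freeze b t.
Proof.
move=> b0 bT; apply: sol_gt0; first by rewrite le_max lexx.
by apply: le_lt_trans bT; rewrite lee_fin ge_max b0 ge_min lexx orbT.
Qed.

Lemma continuous_f_freeze (b : R) : 0 <= b -> (b%:E < T)%E ->
  continuous (fun t => f (freeze b t)).
Proof.
move=> b0 bT; case: pcf => cf _.
apply: (continuous_comp_within cf); first exact: continuous_freeze.
by move=> t; rewrite /= in_itv/= andbT freeze_gt0.
Qed.

Lemma f_freeze_ge0 (b t : R) : 0 <= b -> (b%:E < T)%E -> 0 <= f (freeze b t).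
Proof. by move=> b0 bT; case: pcf => _ fp; rewrite ltW// fp// freeze_gt0. Qed.

Lemma conv_freeze (b t : R) : 0 <= t <= b ->
  conv w (fun s => f (x s)) t = conv w (fun s => f (freeze b s)) t.
Proof.
move=> /andP[t0 tb]; apply: eq_conv => s /andP[s0 st].
by rewrite freezeE// s0 (le_trans st).
Qed.

Lemma sol_is_derive (t : R) : 0 < t -> (t%:E < T)%E ->
  is_derive t 1 x (h t + conv w (fun s => f (x s)) t).
Proof. by case: sol => _ _ _ _ + t0 tT; exact. Qed.

Lemma prim_h_ge0 (t : R) : 0 <= t -> 0 <= prim h t.
Proof. by move=> t0; rewrite primE//; exact: H_ge0. Qed.

Lemma within_sol_sub_h (s t : R) : 0 <= s -> (t%:E < T)%E ->
  {within `[s, t], continuous (fun r => x r - prim h r)}.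
Proof.
move=> s0 tT r; apply: (@continuousB _ _ (subspace `[s, t]) x (prim h)).
  exact: sol_continuous.
by apply/continuous_subspaceT/continuous_prim.
Qed.

Lemma is_derive_sol_sub_h (t : R) : 0 < t -> (t%:E < T)%E ->
  is_derive t 1 (fun r => x r - prim h r) (conv w (fun s => f (x s)) t).
Proof.
move=> t0 tT; have d1 := sol_is_derive t0 tT; have d2 := is_derive_prim t ch.
by apply: (is_derive_eq (is_deriveB d1 d2)); rewrite addrAC subrr add0r.
Qed.

(** Once [h] is removed, the derivative is a convolution of nonnegative functions. The solution
    itself may fail to be monotone, as [h] can change sign. *)
Lemma sol_sub_h_nd (s t : R) : 0 <= s -> s <= t -> (t%:E < T)%E ->
  x s - prim h s <= x t - prim h t.
Proof.
move=> s0 st tT; rewrite -subr_ge0 -(mul0r (t - s)).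
apply: (@derive_ge _ _ (fun r => x r - prim h r)
  (fun r => conv w (fun u => f (x u)) r)) => //.
- exact: within_sol_sub_h.
- move=> r /andP[sr rt]; apply: is_derive_sol_sub_h; first exact: le_lt_trans sr.
  by apply: lt_trans tT; rewrite lte_fin.
- move=> r /andP[sr rt]; apply: conv_ge0 => // u /andP[u0 ur].
  case: pcf => _ fp; rewrite ltW// fp// sol_gt0//.
  by apply: le_lt_trans tT; rewrite lee_fin (le_trans ur)// ltW.
Qed.

Lemma sol_sub_h_ge (t : R) : 0 <= t -> (t%:E < T)%E -> psi <= x t - prim h t.
Proof.
move=> t0 tT; have := sol_sub_h_nd (lexx 0) t0 tT.
by case: sol => _ -> _ _ _; rewrite prim0 subr0.
Qed.

Lemma sol_ge (t : R) : 0 <= t -> (t%:E < T)%E -> psi <= x t.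
Proof.
move=> t0 tT; apply: (le_trans (sol_sub_h_ge t0 tT)).
by rewrite lerBlDr lerDl prim_h_ge0.
Qed.

End Solutions.

(** * Monotonicity up to a constant factor *)

Section QuasiIncreasing.
Variable R : realType.

(** On [[psi, +oo[] the function [f] lies between [a * phi] and [A * phi] for an increasing [phi]:
    near infinity with factors 1/2 and 2 from the limit, on the remaining segment by comparing
    extreme values. Hence [k = a / A]. *)
Lemma quasi_increasing (f : R -> R) (psi : R) : pos_cont f -> asympt_increasing f ->
  0 < psi -> exists2 k, 0 < k & forall u v, psi <= u -> u <= v -> k * f u <= f v.
Proof.
move=> [cf fp] [phi [_ [phip [incr fphi]]]] psi0.
have [M [_ HM]] : \forall u \near +oo, `|1 - f u / phi u| <= 2^-1.
  by move/cvgrPdist_le : fphi; apply; rewrite invr_gt0.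
pose u0 := Num.max M psi + 1.
have psiu : psi <= u0.
  by apply: (@le_trans _ _ (Num.max M psi)); rewrite ?lerDl// le_max lexx orbT.
have u00 : 0 < u0 by exact: lt_le_trans psiu.
have cf' : {within `[psi, u0], continuous f}.
  by apply: continuous_subspaceW cf => s; rewrite /= !in_itv/= andbT => /andP[/(lt_le_trans psi0)].
have nd u v : 0 < u -> u <= v -> phi u <= phi v.
  by move=> up; rewrite le_eqVlt => /predU1P[->//|uv]; apply/ltW/incr.
have large u : u0 <= u -> 2^-1 * phi u <= f u /\ f u <= 2 * phi u.
  move=> uu; have Mu : M < u.
    by apply: (@lt_le_trans _ _ u0) => //; rewrite /u0 ltr_pwDr// le_max lexx.
  have up := phip _ (lt_le_trans u00 uu).
  move: (HM _ Mu); rewrite ler_norml => /andP[H1 H2]; split.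
    by rewrite -ler_pdivlMr//; lra.
  by rewrite -ler_pdivrMr//; lra.
have [c ccd cmin] := EVT_min psiu cf'.
have [d dcd dmax] := EVT_max psiu cf'.
have fc : 0 < f c by apply: fp; move: ccd; rewrite in_itv/= => /andP[/(lt_le_trans psi0)].
have fd : 0 < f d by apply: fp; move: dcd; rewrite in_itv/= => /andP[/(lt_le_trans psi0)].
have pu0 := phip _ u00; have ppsi := phip _ psi0.
pose a := Num.min 2^-1 (f c / phi u0); pose A := Num.max 2 (f d / phi psi).
have a0 : 0 < a by rewrite /a lt_min invr_gt0 ltr0n divr_gt0.
have A0 : 0 < A by rewrite /A lt_max ltr0n.
have bnd u : psi <= u -> a * phi u <= f u /\ f u <= A * phi u.
  move=> pu; have up := phip _ (lt_le_trans psi0 pu).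
  have [uu|/ltW uu] := leP u0 u.
    have [l1 l2] := large _ uu; split.
      by apply: le_trans l1; rewrite ler_wpM2r ?(ltW up)// ge_min lexx.
    by apply: (le_trans l2); rewrite ler_wpM2r ?(ltW up)// le_max lexx.
  have ui : u \in `[psi, u0] by rewrite in_itv/= pu.
  split.
    apply: le_trans (cmin _ ui).
    apply: (@le_trans _ _ (f c / phi u0 * phi u)).
      by rewrite ler_wpM2r ?(ltW up)// ge_min lexx orbT.
    rewrite mulrAC ler_pdivrMr// ler_wpM2l ?(ltW fc)// nd//.
    exact: lt_le_trans pu.
  apply: (le_trans (dmax _ ui)).
  apply: (@le_trans _ _ (f d / phi psi * phi u)).
    by rewrite mulrAC ler_pdivlMr// ler_wpM2l ?(ltW fd)// nd.
  by rewrite ler_wpM2r ?(ltW up)// le_max lexx orbT.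
exists (a / A); first by rewrite divr_gt0.
move=> u v pu uv.
have [_ ub] := bnd _ pu; have [lb _] := bnd _ (le_trans pu uv).
apply: le_trans lb; rewrite mulrAC ler_pdivrMr// -mulrA ler_wpM2l ?(ltW a0)//.
apply: (le_trans ub); rewrite mulrC ler_wpM2r ?(ltW A0)// nd//.
exact: lt_le_trans pu.
Qed.

End QuasiIncreasing.

(** * Solutions are not global *)

Section NoGlobalSolution.
Variable R : realType.
Notation mu := (@lebesgue_measure R).
Variables (f : R -> R) (psi k : R).
Hypotheses (pcf : pos_cont f) (osg : osgood_cond f) (psi0 : 0 < psi)
  (k0 : 0 < k) (fk : forall u v, psi <= u -> u <= v -> k * f u <= f v).

Let fp u : 0 < u -> 0 < f u. Proof. by case: pcf => _; apply. Qed.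

Section Doubling.
Hypothesis fsup : f x / x @[x --> +oo] --> +oo.

(** Both quantities are compared with [f z * z]: as [v - z >= z], the increment of [Fint f] is at
    least [k * f z * z], while [Fint f z] is at most [(1 + k^-1) * f z * z]. *)
Lemma Fint_doubling : exists C U, 0 < C /\ forall z v, U <= z -> 2 * z <= v ->
  Fint f v <= C * (Fint f v - Fint f z).
Proof.
have [u1 [u10 fu1]] := near_f_ge fsup 1.
(* For [z >= U] one has [Fint f psi <= z] and [1 <= z <= f z], which absorbs [Fint f psi] into
   [f z * z]. *)
pose U := Num.max (Num.max psi u1) (Num.max 1 (Fint f psi)).
exists (1 + (1 + k^-1) / k), U.
have C0 : 0 < (1 + k^-1) / k by rewrite divr_gt0// addr_gt0// invr_gt0.
split; first by rewrite addr_gt0.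
move=> z v; rewrite !ge_max => /andP[/andP[pz uz] /andP[z1 Fz]] zv.
have z0 : 0 < z by exact: lt_le_trans pz.
have zv' : z <= v by lra.
have lo : k * f z * z <= Fint f v - Fint f z.
  apply: (@le_trans _ _ (k * f z * (v - z))).
    by apply: ler_wpM2l; [rewrite mulr_ge0 ?ltW// fp|lra].
  by apply: Fint_ge => // s /andP[zs sv]; apply: fk => //; exact: ltW.
have hi : Fint f z - Fint f psi <= k^-1 * f z * z.
  apply: (@le_trans _ _ (k^-1 * f z * (z - psi))).
    apply: Fint_le => // s /andP[ps sz].
    by rewrite -ler_pdivrMl ?invr_gt0// invrK fk// ltW.
  apply: ler_wpM2l; first by rewrite mulr_ge0 ?invr_ge0 ?ltW// fp.
  by have := psi0; lra.
have Fpsi : Fint f psi <= f z * z.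
  apply: (le_trans Fz); rewrite -[leLHS]mul1r ler_pM ?(ltW z0)//.
  by apply: (le_trans z1); rewrite -[z in z <= _]mul1r fu1.
have Fz' : Fint f z <= (1 + k^-1) / k * (k * f z * z).
  rewrite [leRHS](_ : _ = (1 + k^-1) * f z * z); last by field; rewrite gt_eqF.
  by rewrite !mulrDl mul1r; lra.
rewrite mulrDl mul1r; set Fd := Fint f v - Fint f z in lo *.
have := ler_wpM2l (ltW C0) lo; rewrite /Fd in lo *; lra.
Qed.

End Doubling.

(* A second-order differential inequality [Z'' >= c f(Z)] started at rest:
   multiplying by [Z'] gives [Z'^2 >= 2 c (F(Z) - F(Z t0))]. *)
Section SecondOrder.
Variables (c t0 b : R) (Z V A : R -> R).
Hypotheses (c0 : 0 < c) (t0b : t0 <= b) (dZ : forall t : R, is_derive t 1 Z (V t))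
  (dV : forall t : R, is_derive t 1 V (A t)) (V0 : V t0 = 0) (psiZ : psi <= Z t0)
  (A_ge0 : forall t, t0 <= t <= b -> 0 <= A t)
  (A_ge : forall t v, t0 <= t <= b -> psi <= v -> v <= Z t -> c * f v <= A t).

Let cV : continuous V. Proof. by move=> t; exact: is_derive_continuous (dV t). Qed.
Let cZ : continuous Z. Proof. by move=> t; exact: is_derive_continuous (dZ t). Qed.

Let V_nd (s t : R) : t0 <= s -> s <= t -> t <= b -> V s <= V t.
Proof.
move=> t0s st tb; rewrite -subr_ge0 -(mul0r (t - s)).
apply: (@derive_ge _ _ _ A) => //; first exact: continuous_subspaceT.
by move=> r /andP[/ltW sr /ltW rt]; rewrite A_ge0// (le_trans t0s)// (le_trans rt).
Qed.

Let V_ge0 t : t0 <= t -> t <= b -> 0 <= V t.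
Proof. by move=> t0t tb; rewrite -V0 V_nd. Qed.

Let VZ (s t : R) : t0 <= s -> s <= t -> t <= b -> V s * (t - s) <= Z t - Z s.
Proof.
move=> t0s st tb; apply: (@derive_ge _ _ _ V) => //; first exact: continuous_subspaceT.
by move=> r /andP[/ltW sr /ltW rt]; rewrite V_nd// (le_trans rt).
Qed.

Let Z_nd (s t : R) : t0 <= s -> s <= t -> t <= b -> Z s <= Z t.
Proof.
move=> t0s st tb; rewrite -subr_ge0; apply: le_trans (VZ t0s st tb).
by rewrite mulr_ge0 ?subr_ge0// V_ge0// (le_trans st).
Qed.

Let Z_gt0 t : t0 <= t -> t <= b -> 0 < Z t.
Proof.
by move=> t0t tb; rewrite (lt_le_trans psi0)// (le_trans psiZ)// Z_nd.
Qed.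

Let energy t : t0 <= t -> t <= b ->
  2 * c * (Fint f (Z t) - Fint f (Z t0)) <= V t ^+ 2.
Proof.
move=> t0t tb.
have [E EE dE] : exists2 E : R -> R, forall s, E s = V s * V s - 2 * c * Fint f (Z s) &
    forall s, t0 <= s -> s <= t -> is_derive s 1 E (2 * V s * (A s - c * f (Z s))).
  exists (fun s => V s * V s - 2 * c * Fint f (Z s)) => [//|s ts st].
  have sb := le_trans st tb.
  have dF := is_derive1_comp (is_derive_Fint pcf osg (Z_gt0 ts sb)) (dZ s).
  apply: (is_derive_eq (is_deriveB (is_deriveM (dV s) (dV s)) (is_deriveZ (2 * c) dF))).
  by rewrite /GRing.scale/=; ring.
have : 0 * (t - t0) <= E t - E t0.
  apply: (@derive_ge _ 0 E (fun s => 2 * V s * (A s - c * f (Z s))) t0 t t0t).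
  - apply: derivable_within_continuous => s; rewrite in_itv/= => /andP[ts st].
    exact: (@ex_derive _ _ _ _ _ _ _ (dE _ ts st)).
  - by move=> s /andP[/ltW ts /ltW st]; exact: dE.
  - move=> s /andP[/ltW ts /ltW st]; have sb := le_trans st tb.
    rewrite mulr_ge0//; first by rewrite mulr_ge0// V_ge0.
    rewrite subr_ge0; apply: A_ge => //; first by rewrite ts.
    by rewrite (le_trans psiZ)// Z_nd.
rewrite mul0r !EE V0 mulr0 expr2; lra.
Qed.

(** The first quarter of the window builds up slope, the second quarter turns it into a doubling of
    [Z]. From the midpoint on, the energy bound reads [V >= Num.sqrt (2 * c / C) * Num.sqrt (Fint f
    Z)], so [FB f (Z t)] falls at a fixed rate during the remaining half; being nonnegative at the
    end, it was at least the total drop at the midpoint. *)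
Lemma second_order_drop (C : R) : 0 < C -> (forall v, 2 * Z t0 <= v ->
    Fint f v <= C * (Fint f v - Fint f (Z t0))) ->
  16 / (c * (b - t0) ^+ 2) * Z t0 <= f (Z t0) -> t0 < b ->
  exists2 v, 2 * Z t0 <= v & Num.sqrt (2 * c / C) * ((b - t0) / 2) <= FB f v.
Proof.
move=> C0 FC fz0 t0b'.
pose d := b - t0; have d0 : 0 < d by rewrite subr_gt0.
have bE : b = t0 + d by rewrite /d addrC subrK.
have pz0 := lt_le_trans psi0 psiZ.
have t0t0b : t0 <= t0 <= b by rewrite lexx.
have V_lin t : t0 <= t -> t <= b -> c * f (Z t0) * (t - t0) <= V t.
  move=> t0t tb; rewrite -[V t]subr0 -V0.
  apply: (@derive_ge _ _ _ A) => //; first exact: continuous_subspaceT.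
  move=> s /andP[/ltW ts /ltW st]; have sb := le_trans st tb.
  by apply: A_ge; rewrite ?ts// Z_nd.
have t0q : t0 <= t0 + d / 4 by lra.
have qm : t0 + d / 4 <= t0 + d / 2 by lra.
have t0m : t0 <= t0 + d / 2 by lra.
have mb : t0 + d / 2 <= b by rewrite bE; lra.
have qb := le_trans qm mb.
have Z2 : 2 * Z t0 <= Z (t0 + d / 2).
  have H1 := V_lin _ t0q qb; have H2 := VZ t0q qm mb; have H3 := Z_nd (lexx t0) t0q qb.
  have e1 : t0 + d / 4 - t0 = d / 4 by ring.
  have e2 : t0 + d / 2 - (t0 + d / 4) = d / 4 by field.
  rewrite e1 in H1; rewrite e2 in H2.
  suff : Z t0 <= V (t0 + d / 4) * (d / 4) by lra.
  have d4 : 0 <= d / 4 by lra.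
  apply: le_trans (ler_wpM2r d4 H1).
  (* The 16 in the hypothesis cancels the two quarter lengths [d / 4]. *)
  apply: (@le_trans _ _ (c * (16 / (c * d ^+ 2) * Z t0) * (d / 4) * (d / 4))).
    rewrite le_eqVlt; apply/orP; left; apply/eqP; field.
    by rewrite !gt_eqF.
  do 2 apply: ler_wpM2r => //.
  by apply: ler_wpM2l => //; exact: ltW.
exists (Z (t0 + d / 2)) => //; rewrite -/d.
have dFZ s : t0 <= s -> s <= b -> is_derive s 1 (fun r => FB f (Z r))
    (- (V s / Num.sqrt (Fint f (Z s)))).
  move=> ts sb; have := is_derive1_comp (is_derive_FB pcf osg (Z_gt0 ts sb)) (dZ s).
  by move=> H; apply: (is_derive_eq H); rewrite mulNr mulrC.
have : FB f (Z b) - FB f (Z (t0 + d / 2)) <= - Num.sqrt (2 * c / C) * (b - (t0 + d / 2)).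
  apply: (@derive_le _ _ (fun r => FB f (Z r)) (fun s => - (V s / Num.sqrt (Fint f (Z s)))) _ _ mb).
  - apply: derivable_within_continuous => s; rewrite in_itv/= => /andP[ts sb].
    exact: (@ex_derive _ _ _ _ _ _ _ (dFZ _ (le_trans t0m ts) sb)).
  - by move=> s /andP[/ltW ts /ltW sb]; apply: dFZ => //; exact: le_trans ts.
  move=> s /andP[/ltW ts /ltW sb]; rewrite lerN2.
  have t0s := le_trans t0m ts.
  have F0 := Fint_gt0 pcf osg (Z_gt0 t0s sb).
  rewrite ler_pdivlMr ?sqrtr_gt0// -sqrtrM; last by rewrite divr_ge0 ?mulr_ge0 ?ltW.
  rewrite -[V s]ger0_norm ?V_ge0// -sqrtr_sqr ler_sqrt ?sqr_ge0//.
  apply: le_trans (energy t0s sb).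
  rewrite -[leLHS]mulrA ler_wpM2l ?mulr_ge0 ?(ltW c0)//.
  rewrite mulrC ler_pdivrMr// [leRHS]mulrC; apply: FC.
  exact: le_trans Z2 (Z_nd t0m ts sb).
have FB0 := FB_ge0 f (Z b).
have -> : b - (t0 + d / 2) = d / 2 by rewrite bE; field.
rewrite mulNr; lra.
Qed.

End SecondOrder.

(** * A solution that is large too early cannot survive a full window *)

Section Late.
Variables (w h : R -> R) (T : \bar R) (x : R -> R).
Hypotheses (cw : continuous w) (w_ge0 : forall s, 0 <= w s)
  (ch : continuous h) (H_ge0 : forall t, 0 <= t -> 0 <= Hint h t)
  (sol : is_sol f w h psi T x).
Variables (m d : R).
Hypotheses (m0 : 0 < m) (d0 : 0 < d) (wm : forall s, 0 <= s <= d -> m <= w s).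

(** The comparison function [Z] integrates [m * f (x s)] twice from [t0]. It stays below [x], so
    quasi-monotonicity turns its second derivative into a bound [m * k * f v] for every [v] between
    [psi] and [Z], as [second_order_drop] requires. *)
Lemma window_drop (C t0 : R) : 0 <= t0 -> ((t0 + d)%:E < T)%E -> 0 < C ->
  (forall v, 2 * (x t0 - prim h t0) <= v ->
    Fint f v <= C * (Fint f v - Fint f (x t0 - prim h t0))) ->
  16 / (m * k * d ^+ 2) * (x t0 - prim h t0) <= f (x t0 - prim h t0) ->
  exists2 v, 2 * (x t0 - prim h t0) <= v &
    Num.sqrt (2 * (m * k) / C) * (d / 2) <= FB f v.
Proof.
move=> t00 tT C0.
have psi_z0 : psi <= x t0 - prim h t0.
  apply: (sol_sub_h_ge pcf w_ge0 ch sol) => //.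
  by apply: le_lt_trans tT; rewrite lee_fin lerDl ltW.
have [z0 z0E] : exists z, x t0 - prim h t0 = z by exists (x t0 - prim h t0).
rewrite z0E in psi_z0 *; move=> FC fz0.
have [b bE] : exists b, b = t0 + d by exists (t0 + d).
rewrite -bE in tT.
have t0b : t0 < b by rewrite bE ltrDl.
have b0 : 0 <= b := le_trans t00 (ltW t0b).
have bT (t : R) : t <= b -> (t%:E < T)%E.
  by move=> tb; apply: le_lt_trans tT; rewrite lee_fin.
have [G [cG G_ge0 GE convG]] : exists G : R -> R, [/\ continuous G,
    forall s, 0 <= G s, forall s, 0 <= s <= b -> G s = f (x s) &
    forall t, 0 <= t <= b -> conv w (fun s => f (x s)) t = conv w G t].
  exists (fun s => f (freeze x b s)); split.
  - exact: (continuous_f_freeze pcf sol).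
  - by move=> s; exact: (f_freeze_ge0 pcf sol).
  - by move=> s sb; rewrite freezeE.
  - by move=> t; exact: conv_freeze.
have [V dV VE] : exists2 V : R -> R, forall t : R, is_derive t 1 V (m * G t) &
    forall t, V t = m * (prim G t - prim G t0).
  exists (fun t => m * (prim G t - prim G t0)) => [t|//].
  have := is_deriveZ m (is_deriveB (is_derive_prim t cG) (@is_derive_cst _ R R (prim G t0) t 1)).
  by rewrite subr0.
have cV : continuous V by move=> t; exact: is_derive_continuous (dV t).
have [Z dZ ZE] : exists2 Z : R -> R, forall t : R, is_derive t 1 Z (V t) & Z t0 = z0.
  exists (fun t => z0 + (prim V t - prim V t0)) => [t|]; last by rewrite subrr addr0.
  have := is_deriveD (@is_derive_cst _ R R z0 t 1)
    (is_deriveB (is_derive_prim t cV) (@is_derive_cst _ R R (prim V t0) t 1)).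
  by rewrite subr0 add0r.
have cZ : continuous Z by move=> t; exact: is_derive_continuous (dZ t).
(* Inside the window lags measured from [t0] are at most [d], so the kernel is at least [m] there,
   and the history before [t0] only helps. *)
have Z_le t : t0 <= t -> t <= b -> Z t <= x t - prim h t.
  move=> t0t tb.
  have : 0 * (t - t0) <= (x t - prim h t - Z t) - (x t0 - prim h t0 - Z t0).
    apply: (@derive_ge _ _ (fun r => x r - prim h r - Z r)
      (fun r => conv w (fun u => f (x u)) r - V r)) => //.
    - move=> r; apply: (@continuousB _ _ (subspace `[t0, t]) (fun r => x r - prim h r) Z).
        exact: (within_sol_sub_h ch sol t00 (bT _ tb)).
      exact: continuous_subspaceT.
    - move=> r /andP[t0r rt]; apply: is_deriveB.
      apply: (is_derive_sol_sub_h ch sol); first exact: le_lt_trans t0r.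
      by apply: bT; rewrite (le_trans (ltW rt)).
    - move=> r /andP[/ltW t0r /ltW rt]; rewrite subr_ge0.
      have rb := le_trans rt tb.
      rewrite convG ?rb ?andbT ?(le_trans t00 t0r)// VE -Rintegral_prim//.
      apply: conv_ge => //.
      by move=> s /andP[s0 sr]; apply: wm; rewrite s0/=; move: rb; rewrite bE; lra.
  rewrite mul0r ZE z0E; lra.
have dE : d = b - t0 by rewrite bE addrAC subrr add0r.
rewrite dE -ZE; apply: (@second_order_drop (m * k) t0 b Z V (fun t => m * G t)) => //.
- by rewrite mulr_gt0.
- exact: ltW.
- by rewrite VE subrr mulr0.
- by rewrite ZE.
- by move=> t _; rewrite mulr_ge0// ltW.
- move=> t v /andP[t0t tb] pv vZ; have t00t := le_trans t00 t0t.
  rewrite -mulrA ler_wpM2l ?(ltW m0)// GE ?t00t//; apply: fk => //.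
  apply: (le_trans vZ); apply: (le_trans (Z_le _ t0t tb)).
  by rewrite lerBlDr lerDl (prim_h_ge0 ch H_ge0).
- by rewrite ZE.
- by rewrite ZE -dE.
Qed.

(** [FB] tends to 0, whereas [window_drop] bounds it below by a fixed positive number at some
    argument beyond twice the starting value. *)
Lemma late_start_contra : f x / x @[x --> +oo] --> +oo ->
  exists Z0, forall t0, 0 <= t0 -> ((t0 + d)%:E < T)%E ->
  Z0 <= x t0 - prim h t0 -> False.
Proof.
move=> fsup; have [C [U [C0 FC]]] := Fint_doubling fsup.
have [u1 [u10 fu1]] := near_f_ge fsup (16 / (m * k * d ^+ 2)).
have K0 : 0 < Num.sqrt (2 * (m * k) / C) * (d / 2).
  by rewrite mulr_gt0 ?divr_gt0// sqrtr_gt0 divr_gt0// !mulr_gt0.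
have [M [_ HM]] : \forall u \near +oo, FB f u < Num.sqrt (2 * (m * k) / C) * (d / 2).
  exact: cvgr_lt (FB_cvg0 pcf osg) _ K0.
(* [U] serves the doubling estimate, [u1] the superlinear growth; [psi] and [M + 1] put every
   argument beyond twice the starting value past [M]. *)
exists (Num.max (Num.max U u1) (Num.max psi (M + 1))).
move=> t0 t00 t0T; rewrite !ge_max => /andP[/andP[Uz uz] /andP[pz Mz]].
have [v zv] := window_drop t00 t0T C0 (fun v => FC _ v Uz) (fu1 _ uz).
by apply/negP; rewrite -ltNge; apply: HM; have := psi0; lra.
Qed.

(** After time [d] the convolution always sees a full window with [f (x s) >= k * f psi], so for a
    global solution [x - prim h] grows at least linearly and passes any threshold. *)
Lemma sol_finite : f x / x @[x --> +oo] --> +oo -> T != +oo%E.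
Proof.
move=> fsup; apply/eqP => Too.
have [Z0 HZ] := late_start_contra fsup.
have fin (t : R) : (t%:E < T)%E by rewrite Too ltry.
pose c := m * (k * f psi * d).
have c0 : 0 < c by rewrite !mulr_gt0// fp.
have lin t : d <= t -> c * (t - d) <= (x t - prim h t) - (x d - prim h d).
  move=> dt; apply: (@derive_ge _ _ (fun r => x r - prim h r)
    (fun r => conv w (fun u => f (x u)) r)) => //.
  - exact: (within_sol_sub_h ch sol (ltW d0) (fin t)).
  - by move=> r /andP[dr _]; apply: (is_derive_sol_sub_h ch sol) => //; exact: lt_trans dr.
  move=> r /andP[/ltW dr _].
  have r0 : 0 <= r by rewrite (le_trans (ltW d0)).
  have cG := continuous_f_freeze pcf sol r0 (fin r).
  rewrite (@conv_freeze _ f w x r) ?r0 ?lexx//.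
  apply: (@le_trans _ _ (m * Rintegral mu `[r - d, r] (fun s => f (freeze x r s)))).
    rewrite ler_wpM2l ?(ltW m0)//.
    have {1}-> : d = r - (r - d) by ring.
    apply: Rintegral_ge => //; first by rewrite gerBl ltW.
    move=> s /andP[/ltW rs /ltW sr]; rewrite freezeE ?sr ?andbT; last by lra.
    apply: fk => //; apply: (sol_ge pcf w_ge0 ch H_ge0 sol) => //; lra.
  apply: conv_ge => //; first by rewrite subr_ge0.
  - by rewrite gerBl ltW.
  - by move=> s; exact: (f_freeze_ge0 pcf sol).
  - by move=> s; rewrite subKr; exact: wm.
(* At this time the linear lower bound has gained exactly the absolute value of [Z0]. *)
pose t := d + `|Z0| / c.
have tdE : t - d = `|Z0| / c by rewrite /t addrAC subrr add0r.
have td : d <= t by rewrite /t lerDl divr_ge0// ltW.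
apply: (HZ t) => //; first by rewrite (le_trans (ltW d0)).
have := lin t td; rewrite tdE mulrC divfK ?gt_eqF// => H.
have := sol_sub_h_ge pcf w_ge0 ch sol (ltW d0) (fin d).
have := ler_norm Z0; have := psi0; lra.
Qed.

End Late.

End NoGlobalSolution.

(** * Continuation of bounded solutions *)

Section Continuation.
Variable R : realType.
Notation mu := (@lebesgue_measure R).
Variables (f w h : R -> R) (psi Tf : R) (x : R -> R).
Hypotheses (pcf : pos_cont f)
  (cw : continuous w) (w_ge0 : forall s, 0 <= w s)
  (ch : continuous h) (H_ge0 : forall t, 0 <= t -> 0 <= Hint h t)
  (psi0 : 0 < psi) (sol : is_sol f w h psi Tf%:E x).

Let Tf0 : 0 < Tf. Proof. by case: sol; rewrite lte_fin. Qed.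

(** [x - prim h] is monotone and bounded, so [x] has a limit at [Tf]. Truncating [f] to values in
    [[psi, M']] gives a bounded nonlinearity to which [peano] applies, and the truncation is
    inactive on a short continuation. *)
Lemma bounded_sol_extends (M : R) : (forall t, 0 <= t < Tf -> x t <= M) ->
  exists (T' : \bar R) (y : R -> R), (Tf%:E < T')%E /\ is_sol f w h psi T' y /\
    (forall t, t \in dom0 Tf%:E -> y t = x t).
Proof.
move=> xM.
have fin (t : R) : t < Tf -> (t%:E < Tf%:E)%E by rewrite lte_fin.
have zcvg : cvg ((fun t => x t - prim h t) t @[t --> Tf^'-]).
  apply: nondecreasing_at_left_is_cvgr.
    near=> a => s t; rewrite !in_itv/= => /andP[as_ sT] /andP[at_ tT] st.
    have a0 : 0 < a by near: a; exact: nbhs_left_gt.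
    by apply: (sol_sub_h_nd pcf w_ge0 ch sol) => //; lra.
  near=> a.
  have a0 : 0 < a by near: a; exact: nbhs_left_gt.
  exists M => _ [t /=] + <-; rewrite in_itv/= => /andP[at_ tT].
  have t0 : 0 <= t by lra.
  apply: (@le_trans _ _ (x t)); last by apply: xM; rewrite t0.
  by rewrite lerBlDr lerDl (prim_h_ge0 ch H_ge0).
pose L := lim ((fun t => x t - prim h t) t @[t --> Tf^'-]) + prim h Tf.
have xL : x t @[t --> Tf^'-] --> L.
  have H : (x t - prim h t) + prim h t @[t --> Tf^'-] --> L.
    by apply: cvgD => //; apply: cvg_at_left_filter; exact: continuous_prim.
  by apply: cvg_trans H; apply: near_eq_cvg; near=> t; rewrite subrK.
pose x1 t := if t < Tf then x t else L.
have cx1 : {within `[0, Tf], continuous x1}.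
  apply/continuous_within_itvP => //; split.
  - move=> t; rewrite in_itv/= => /andP[t0 tT].
    have H := is_derive_continuous (sol_is_derive sol t0 (fin _ tT)).
    have x1t : x1 t = x t by rewrite /x1 tT.
    suff : x1 s @[s --> t] --> x t by rewrite -x1t.
    apply: cvg_trans H; apply: near_eq_cvg; near=> s.
    by rewrite /x1 ifT//; near: s; exact: lt_nbhsl.
  - have T2 : 0 < Tf / 2 by rewrite divr_gt0.
    have T2T : Tf / 2 < Tf by lra.
    have := sol_continuous sol (lexx 0) (fin _ T2T).
    move=> /(continuous_within_itvP _ T2)[_ H _].
    rewrite /x1 Tf0; apply: cvg_trans H; apply: near_eq_cvg; near=> s.
    by rewrite ifT//; near: s; exact: nbhs_right_lt.
  - rewrite {2}/x1 ltxx; apply: cvg_trans xL; apply: near_eq_cvg; near=> s.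
    by rewrite /x1 ifT//; near: s; exact: nbhs_left_lt.
pose xb t := x1 (Num.max 0 (Num.min t Tf)).
have cxb : continuous xb.
  apply: (continuous_comp_within cx1).
    apply: continuous_funmax; first exact: continuous_funcst.
    by apply: continuous_funmin; [exact: continuous_funid|exact: continuous_funcst].
  by move=> t; rewrite /= in_itv/= le_max lexx/= ge_max (ltW Tf0) ge_min lexx orbT.
have xbE t : 0 <= t < Tf -> xb t = x t.
  by move=> /andP[t0 tT]; rewrite /xb min_l ?(ltW tT)// max_r// /x1 tT.
have xbT : xb Tf = L by rewrite /xb minxx max_r ?(ltW Tf0)// /x1 ltxx.
(* Strictly above the limit [L], so that the continuation stays below [M'] for a short time after
   [Tf]. *)
pose M' := Num.max M L + 1.
have MM' : M < M' by rewrite /M' ltr_pwDr// le_max lexx.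
have LM' : L < M' by rewrite /M' ltr_pwDr// le_max lexx orbT.
have psiM' : psi <= M'.
  apply: le_trans (ltW MM'); have := xM 0; rewrite lexx Tf0 => /(_ isT).
  by case: sol => _ ->.
pose F u := f (Num.max psi (Num.min u M')).
have clampP (u : R) : psi <= Num.max psi (Num.min u M') <= M'.
  by rewrite le_max lexx/= ge_max psiM' ge_min lexx orbT.
have cF : continuous F.
  case: pcf => cf _; apply: (continuous_comp_within cf).
    apply: continuous_funmax; first exact: continuous_funcst.
    by apply: continuous_funmin; [exact: continuous_funid|exact: continuous_funcst].
  by move=> t; rewrite /= in_itv/= andbT lt_max psi0.
have F_ge0 u : 0 <= F u by case: pcf => _ fp; rewrite ltW// fp// lt_max psi0.
have [B FB] : exists B, forall u, `|F u| <= B.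
  have cf' : {within `[psi, M'], continuous f}.
    case: pcf => cf _; apply: continuous_subspaceW cf => s.
    by rewrite /= !in_itv/= andbT => /andP[/(lt_le_trans psi0)].
  have [c _ cmax] := EVT_max psiM' cf'.
  exists (f c) => u; rewrite ger0_norm//; apply: cmax; rewrite in_itv/=.
  exact: clampP.
have FE u : psi <= u -> u <= M' -> F u = f u by move=> pu uM; rewrite /F min_l// max_r.
have xpsi t : 0 <= t < Tf -> psi <= x t.
  by move=> /andP[t0 tT]; apply: (sol_ge pcf w_ge0 ch H_ge0 sol) => //; exact: fin.
have cr := continuous_rate cw ch cF cxb.
(* The two sides agree at 0 and their difference has zero derivative; the endpoint [Tf] is then
   reached by continuity. *)
have pic_lt t : 0 <= t < Tf -> picard w h F psi xb t = xb t.
  move=> /andP[t0 tT]; rewrite xbE ?t0//.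
  have cwi : {within `[0, t], continuous (fun r => x r - prim (rate w h F xb) r)}.
    move=> r; apply: (@continuousB _ _ (subspace `[0, t]) x (prim (rate w h F xb))).
      exact: (sol_continuous sol (lexx 0) (fin _ tT)).
    by apply/continuous_subspaceT/continuous_prim.
  have der r : 0 < r < t -> is_derive r 1 (fun r => x r - prim (rate w h F xb) r) 0.
    move=> /andP[r0 rt]; have rT := lt_trans rt tT.
    apply: (is_derive_eq (is_deriveB (sol_is_derive sol r0 (fin _ rT)) (is_derive_prim r cr))).
    rewrite /rate max_l ?(ltW r0)//.
    rewrite (@eq_conv _ w (fun s => f (x s)) (fun s => F (xb s))) ?subrr//.
    move=> s /andP[s0 sr]; have sT := le_lt_trans sr rT.
    rewrite xbE ?s0// FE//; first by rewrite xpsi// s0.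
    by rewrite (le_trans _ (ltW MM'))// xM// s0.
  have H1 := @derive_ge _ 0 _ (fun=> 0) 0 t t0 cwi der (fun _ _ => lexx 0).
  have H2 := @derive_le _ 0 _ (fun=> 0) 0 t t0 cwi der (fun _ _ => lexx 0).
  move: H1 H2; rewrite !mul0r prim0 subr0.
  have -> : x 0 = psi by case: sol.
  rewrite /picard; lra.
have pic t : 0 <= t <= Tf -> picard w h F psi xb t = xb t.
  move=> /andP[t0]; rewrite le_eqVlt => /predU1P[->|tT]; last by rewrite pic_lt// t0.
  have H1 : picard w h F psi xb s @[s --> Tf^'-] --> picard w h F psi xb Tf.
    apply: cvg_at_left_filter; apply: cvgD; first exact: cvg_cst.
    exact: continuous_prim.
  have H2 : picard w h F psi xb s @[s --> Tf^'-] --> xb Tf.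
    have : xb s @[s --> Tf^'-] --> xb Tf by apply: cvg_at_left_filter; exact: cxb.
    apply: cvg_trans; apply: near_eq_cvg; near=> s; rewrite pic_lt//.
    apply/andP; split; last by near: s; exact: nbhs_left_lt.
    by apply: ltW; near: s; exact: nbhs_left_gt.
  exact: (cvg_unique (@Rhausdorff R) H1 H2).
have TT1 : Tf <= Tf + 1 by rewrite lerDl.
have [y [cy yx ypic]] := peano cw ch cF FB (ltW Tf0) TT1 cxb pic.
have cry := continuous_rate cw ch cF cy.
(* The truncated nonlinearity and the kernel are nonnegative, so the integral equation gives
   [y >= psi + prim h]. *)
have ypsi t : 0 <= t <= Tf + 1 -> psi <= y t.
  move=> t01; rewrite -ypic// /picard lerDl; move: t01 => /andP[t0 _].
  apply: le_trans (prim_h_ge0 ch H_ge0 t0) _.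
  rewrite -subr_ge0 !primE// Rintegral_subC//.
  apply: Rintegral_ge0 => s; rewrite /= in_itv/= => /andP[s0 st].
  rewrite /rate addrAC subrr add0r; apply: conv_ge0 => // u _; exact: F_ge0.
have yT : y Tf = L by rewrite yx ?lexx ?(ltW Tf0).
have [e e0 ye] : exists2 e, 0 < e & forall t, `|Tf - t| < e -> y t < M'.
  have : \forall t \near Tf, y t < M' 
    by apply: (@cvgr_lt _ _ (nbhs Tf) _ y (y Tf)); [exact: cy|rewrite yT].
  by move=> /nbhs_normP[e /= e0 H]; exists e => // t te; apply: H.
pose d := Num.min 1 e.
have d0 : 0 < d by rewrite /d lt_min ltr01.
have d1 : d <= 1 by rewrite /d ge_min lexx.
have de : d <= e by rewrite /d ge_min lexx orbT.
have yM t : 0 <= t < Tf + d -> y t <= M'.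
  move=> /andP[t0 tT]; have [tT'|Tt] := ltP t Tf.
    rewrite yx ?t0 ?(ltW tT')// xbE ?t0// (le_trans _ (ltW MM'))// xM//.
    by rewrite t0.
  by apply/ltW/ye; rewrite distrC ger0_norm; lra.
have fy t : 0 <= t < Tf + d -> F (y t) = f (y t).
  move=> tT; apply: FE; last exact: yM.
  by apply: ypsi; move: tT => /andP[-> /=]; lra.
exists (Tf + d)%:E, y; split; first by rewrite lte_fin; lra.
split; last first.
  move=> t; rewrite inE => -[t0]; rewrite lte_fin => tT.
  by rewrite yx ?t0 ?(ltW tT)// xbE// t0.
split.
- by rewrite lte_fin addr_gt0.
- by rewrite yx ?lexx ?(ltW Tf0)// xbE ?lexx//; case: sol.
- exact: continuous_subspaceT.
- move=> t; rewrite inE => -[t0]; rewrite lte_fin => tT.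
  by apply: (lt_le_trans psi0); apply: ypsi; rewrite t0; lra.
move=> t t0; rewrite lte_fin => tT.
apply: (@near_eq_is_derive _ _ _ (cst psi + prim (rate w h F y))).
  near=> s; rewrite fctE/= -/(picard w h F psi y s) ypic//.
  apply/andP; split; first by apply: ltW; near: s; exact: lt_nbhsr.
  apply: ltW; near: s; apply: lt_nbhsl; lra.
have H := is_deriveD (@is_derive_cst _ R R psi t 1) (is_derive_prim t cry).
apply: (is_derive_eq H).
rewrite add0r /rate max_l ?(ltW t0)//; congr (_ + _).
apply: eq_conv => s /andP[s0 st]; apply: fy; rewrite s0; lra.
Unshelve. all: by end_near. Qed.

(** If [x - prim h] were bounded above, so would be [x], and the solution could be extended.
    Otherwise, by monotonicity, each large value of [x - prim h] persists up to [Tf], and [x] lies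
    above it. *)
Lemma maximal_sol_blowup : is_max_sol f w h psi Tf%:E x -> x t @[t --> Tf^'-] --> +oo.
Proof.
move=> [_ maxi]; apply: contrapT => ncvg; apply: maxi.
have fin (t : R) : t < Tf -> (t%:E < Tf%:E)%E by rewrite lte_fin.
have [Mh _ hM] := segment_bounded (ltW Tf0) (continuous_prim ch).
have [A HA] : exists A, forall t, 0 <= t < Tf -> x t - prim h t <= A.
  apply: contrapT => /forallNP unb; apply: ncvg; apply/cvgryPge => A.
  have /existsNP[t /not_implyP[/andP[t0 tT] /negP]] := unb A.
  rewrite -ltNge => At.
  near=> s.
  have ts : t <= s by apply: ltW; near: s; exact: nbhs_left_gt.
  have sT : s < Tf by near: s; exact: nbhs_left_lt.
  have s0 := le_trans t0 ts.
  have := sol_sub_h_nd pcf w_ge0 ch sol t0 ts (fin _ sT).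
  have := prim_h_ge0 ch H_ge0 s0; lra.
apply: (@bounded_sol_extends (A + Mh)) => t /andP[t0 tT].
have := HA t; rewrite t0 tT => /(_ isT).
have := hM t; rewrite t0 (ltW tT) => /(_ isT); rewrite ler_norml => /andP[_].
lra.
Unshelve. all: by end_near. Qed.

End Continuation.

(** * The blow-up rate *)

Section Rate.
Variable R : realType.
Notation mu := (@lebesgue_measure R).

(** On [[0, a]] only the crude bound [K] is available; on [[a, t]] all lags are at most [t - a],
    where the kernel is within [e] of [w 0]. *)
Lemma conv_close (w g : R -> R) (K e a t : R) : continuous w -> continuous g ->
  (forall s, 0 <= g s) -> 0 <= a -> a <= t ->
  (forall s, 0 <= s <= t -> `|w s - w 0| <= K) ->
  (forall s, 0 <= s <= t - a -> `|w s - w 0| <= e) ->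
  `|conv w g t - w 0 * Rintegral mu `[0, t] g| <=
    K * Rintegral mu `[0, a] g + e * Rintegral mu `[a, t] g.
Proof.
move=> cw cg g0 a0 at_ wK we.
have ck := @continuous_conv_integrand _ w g t cw cg.
have piece (c d k : R) : 0 <= c -> c <= d -> d <= t ->
    (forall s, c <= s <= d -> `|w (t - s) - w 0| <= k) ->
    `|Rintegral mu `[c, d] (fun s => w (t - s) * g s) - w 0 * Rintegral mu `[c, d] g|
      <= k * Rintegral mu `[c, d] g.
  move=> c0 cd dt wk.
  have cgZ l : continuous (fun s => l * g s).
    by apply: continuous_funM => //; exact: continuous_funcst.
  rewrite ler_distl -mulrBl -mulrDl -!RintegralZl//; [|exact: continuous_integrable..].
  apply/andP; split; apply: ler_Rintegral => // s /wk; rewrite ler_distl => /andP[l1 l2];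
    by rewrite ler_wpM2r.
rewrite !(@Rintegral_cat _ _ 0 a t)//.
rewrite (_ : conv w g t = Rintegral mu `[0, a] (fun s => w (t - s) * g s) +
   Rintegral mu `[a, t] (fun s => w (t - s) * g s)); last first.
  by rewrite /conv (@Rintegral_cat _ _ 0 a t).
rewrite mulrDr opprD addrACA (le_trans (ler_normD _ _))// lerD// piece//.
  by move=> s /andP[s0 sa]; apply: wK; apply/andP; split; lra.
by move=> s /andP[as_ st]; apply: we; apply/andP; split; lra.
Qed.

Lemma near_at_left (P : R -> Prop) (a b : R) : a < b ->
  (\forall t \near b^'-, P t) ->
  exists2 c, a < c < b & forall t, c <= t < b -> P t.
Proof.
move=> ab; rewrite near_withinE => /nbhs_normP[e /= e0 H].
exists (Num.max ((a + b) / 2) (b - e / 2)).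
  by rewrite lt_max gt_max; apply/andP; split; first apply/orP; last apply/andP;
    try split; try left; lra.
move=> t; rewrite ge_max => /andP[/andP[at_ et] tb].
by apply: H => //=; rewrite gtr0_norm; lra.
Qed.

(** The form in which only the denominator is required to blow up. Past some [c], both
    [(e / 2 + l) * q - p] and [(e / 2 - l) * q + p] are nondecreasing, so [p - l * q] is bounded by
    [e / 2 * q] plus a constant, which [q] eventually absorbs. *)
Lemma lhopital_infty_left (p dp q dq : R -> R) (a b l : R) : a < b ->
  (forall t, a < t < b -> is_derive t 1 p (dp t)) ->
  (forall t, a < t < b -> is_derive t 1 q (dq t)) ->
  (forall t, a < t < b -> 0 < dq t) ->
  q t @[t --> b^'-] --> +oo ->
  dp t / dq t @[t --> b^'-] --> l ->
  p t / q t @[t --> b^'-] --> l.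
Proof.
move=> ab pd qd dq0 qy pq; apply/cvgrPdist_le => e e0.
have e2 : 0 < e / 2 by rewrite divr_gt0.
have : \forall t \near b^'-, `|l - dp t / dq t| <= e / 2 by move/cvgrPdist_le : pq; exact.
move=> /(near_at_left ab)[c /andP[ac cb] Hc].
have growth (r dr : R -> R) t : (forall t, a < t < b -> is_derive t 1 r (dr t)) ->
    (forall t, c < t < b -> 0 <= dr t) -> c <= t -> t < b -> r c <= r t.
  move=> rd dr0 ct tb; rewrite -subr_ge0 -(mul0r (t - c)).
  apply: (@derive_ge _ 0 r dr c t ct).
  - apply: derivable_within_continuous => s; rewrite in_itv/= => /andP[cs st].
    by apply: (@ex_derive _ _ _ _ _ _ _ (rd s _)); apply/andP; split; lra.
  - by move=> s /andP[cs st]; apply: rd; apply/andP; split; lra.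
  - by move=> s /andP[cs st]; apply: dr0; rewrite cs; lra.
have dpq t : c < t < b -> `|dp t - l * dq t| <= e / 2 * dq t.
  move=> /andP[ct tb]; have qt : 0 < dq t by apply: dq0; apply/andP; split; lra.
  rewrite (_ : dp t - l * dq t = - ((l - dp t / dq t) * dq t)); last first.
    by rewrite mulrBl divfK ?gt_eqF// opprB.
  by rewrite normrN normrM (gtr0_norm qt) ler_pM2r// Hc// tb ltW.
have up t := growth (fun t => (e / 2 + l) * q t - p t) (fun t => (e / 2 + l) * dq t - dp t) t.
have dn t := growth (fun t => (e / 2 - l) * q t + p t) (fun t => (e / 2 - l) * dq t + dp t) t.
pose C := `|p c - l * q c| + e / 2 * `|q c|.
near=> t.
have ct : c <= t by apply: ltW; near: t; exact: nbhs_left_gt.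
have tb : t < b by near: t; exact: nbhs_left_lt.
have q1 : 1 <= q t by near: t; move/cvgryPge : qy; exact.
have qC : C / (e / 2) <= q t by near: t; move/cvgryPge : qy; exact.
have q0 : 0 < q t by exact: lt_le_trans q1.
rewrite ler_pdivrMr// in qC.
have {}up : (e / 2 + l) * q c - p c <= (e / 2 + l) * q t - p t.
  apply: (up t _ _ ct tb) => s sab.
    exact: is_deriveB (is_deriveZ (e / 2 + l) (qd s sab)) (pd s sab).
  by have := dpq s sab; rewrite ler_norml => /andP[]; rewrite mulrDl; lra.
have {}dn : (e / 2 - l) * q c + p c <= (e / 2 - l) * q t + p t.
  apply: (dn t _ _ ct tb) => s sab.
    exact: is_deriveD (is_deriveZ (e / 2 - l) (qd s sab)) (pd s sab).
  by have := dpq s sab; rewrite ler_norml => /andP[]; rewrite mulrBl; lra.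
have : `|p t - l * q t| <= e * q t.
  have C1 := ler_norm (p c - l * q c); have C2 := ler_norm (- (p c - l * q c)).
  have C3 := ler_wpM2l (ltW e2) (ler_norm (- q c)).
  rewrite !normrN in C2 C3; rewrite /C in qC.
  rewrite !mulrDl in up dn; rewrite !mulNr in dn; rewrite ler_norml mulrN in C3 *.
  by apply/andP; split; lra.
rewrite -[X in _ -> `|X| <= _](_ : (l * q t - p t) / q t = _); last first.
  by rewrite mulrBl mulfK// gt_eqF.
by rewrite normrM normfV (gtr0_norm q0) ler_pdivrMr// distrC.
Unshelve. all: by end_near. Qed.

(** * Asymptotics of a solution near its blow-up time *)

Variables (f w h : R -> R) (psi Tf : R) (x : R -> R).
Hypotheses (pcf : pos_cont f) (osg : osgood_cond f)
  (cw : continuous w) (w_ge0 : forall s, 0 <= w s) (w0 : 0 < w 0)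
  (ch : continuous h) (sol : is_sol f w h psi Tf%:E x)
  (xy : x t @[t --> Tf^'-] --> +oo).

Let Tf0 : 0 < Tf. Proof. by case: sol; rewrite lte_fin. Qed.
Let fin (t : R) : t < Tf -> (t%:E < Tf%:E)%E. Proof. by rewrite lte_fin. Qed.
Let I t := Rintegral mu `[0, t] (fun s => f (x s)).
Let dx t := h t + conv w (fun s => f (x s)) t.

Let x_gt0 t : 0 <= t < Tf -> 0 < x t.
Proof. by move=> /andP[t0 tT]; apply: (sol_gt0 sol). Qed.

Let I_freeze (b t : R) : 0 <= t <= b -> b < Tf ->
  I t = prim (fun s => f (freeze x b s)) t.
Proof.
move=> /andP[t0 tb] bT; have b0 := le_trans t0 tb.
rewrite primE//; last exact: (continuous_f_freeze pcf sol b0 (fin bT)).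
apply: eq_Rintegral => s; rewrite inE/= in_itv/= => /andP[s0 st].
by rewrite freezeE// s0 (le_trans st).
Qed.

Let is_derive_I t : 0 < t < Tf -> is_derive t 1 I (f (x t)).
Proof.
move=> /andP[t0 tT]; have [b tb bT] : exists2 b, t < b & b < Tf.
  by exists ((t + Tf) / 2); lra.
have b0 : 0 <= b by lra.
have cG := continuous_f_freeze pcf sol b0 (fin bT).
apply: (@near_eq_is_derive _ _ _ (prim (fun s => f (freeze x b s)))).
  near=> s; rewrite (@I_freeze b)//; apply/andP; split.
    by apply: ltW; near: s; exact: lt_nbhsr.
  by apply: ltW; near: s; exact: lt_nbhsl.
have := is_derive_prim t cG; rewrite freezeE//.
by rewrite (ltW t0) ltW.
Unshelve. all: by end_near. Qed.

Let I_nd s t : 0 <= s -> s <= t -> t < Tf -> I s <= I t.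
Proof.
move=> s0 st tT; have t0 := le_trans s0 st.
have cG := continuous_f_freeze pcf sol t0 (fin tT).
rewrite !(@I_freeze t) ?s0 ?t0 ?lexx// -subr_ge0 -Rintegral_prim//.
by apply: Rintegral_ge0 => r _; exact: (f_freeze_ge0 pcf sol).
Qed.

Let dx_close (K e a t : R) : 0 <= a -> a <= t -> t < Tf ->
  (forall s, 0 <= s <= Tf -> `|w s - w 0| <= K) ->
  (forall s, 0 <= s <= Tf - a -> `|w s - w 0| <= e) -> 0 <= e -> 0 <= K ->
  `|dx t - h t - w 0 * I t| <= K * I a + e * I t.
Proof.
move=> a0 at_ tT wK we e0 K0; have t0 := le_trans a0 at_.
have cG := continuous_f_freeze pcf sol t0 (fin tT).
have G0 := fun s => f_freeze_ge0 pcf sol s t0 (fin tT).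
have Ia : I a = Rintegral mu `[0, a] (fun s => f (freeze x t s)).
  by rewrite (@I_freeze t) ?a0// primE.
have It : I t = Rintegral mu `[0, t] (fun s => f (freeze x t s)).
  by rewrite (@I_freeze t) ?t0 ?lexx// primE.
rewrite (_ : dx t - h t = conv w (fun s => f (freeze x t s)) t); last first.
  by rewrite /dx (@conv_freeze _ f w x t) ?t0 ?lexx//; ring.
rewrite It Ia; apply: (le_trans (@conv_close _ _ K e a t _ _ _ _ _ _ _)) => //.
- by move=> s /andP[s0 st]; apply: wK; rewrite s0; lra.
- by move=> s /andP[s0 st]; apply: we; rewrite s0; lra.
rewrite lerD2l ler_wpM2l// (@Rintegral_cat _ _ 0 a t)// lerDr.
by apply: Rintegral_ge0 => s _; exact: G0.
Qed.

Let wK : exists2 K, 0 <= K & forall s, 0 <= s <= Tf -> `|w s - w 0| <= K.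
Proof.
apply: segment_bounded; first exact: ltW.
by apply: continuous_funB => //; exact: continuous_funcst.
Qed.

(** Were [I] bounded, [dx_close] would bound the derivative of [x] from above, and [x] could not
    blow up in finite time. *)
Let I_cvgy : I t @[t --> Tf^'-] --> +oo.
Proof.
apply/cvgryPge => A.
have [[t /andP[t0 tT] At]|nA] := pselect (exists2 t, 0 < t < Tf & A <= I t).
  near=> s; apply: (le_trans At); apply: I_nd; first exact: ltW.
    by apply: ltW; near: s; exact: nbhs_left_gt.
  by near: s; exact: nbhs_left_lt.
have [K K0 HK] := wK.
have [Mh Mh0 hM] := segment_bounded (ltW Tf0) ch.
have IA t : 0 < t < Tf -> I t <= A.
  by move=> tT; have [//|/ltW At] := leP (I t) A; exfalso; apply: nA; exists t.
have T2 : 0 < Tf / 2 < Tf by have := Tf0; move=> ?; apply/andP; split; lra.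
(* [dx_close] with [a = t] and [e = K] gives the derivative bound [Mh + (w 0 + 2 * K) * I t]. *)
pose L := Mh + (w 0 + (K + K)) * `|A|.
have xL t : Tf / 2 <= t < Tf -> x t - x (Tf / 2) <= L * Tf.
  move=> /andP[t2 tT].
  have L0 : 0 <= L.
    by rewrite addr_ge0// mulr_ge0// !addr_ge0// ltW.
  apply: (@le_trans _ _ (L * (t - Tf / 2))); last by rewrite ler_wpM2l//; lra.
  apply: (@derive_le _ L x dx _ _ t2).
  - by apply: (sol_continuous sol) => //; lra.
  - move=> s /andP[s2 st]; apply: (sol_is_derive sol); first lra.
    by apply: fin; lra.
  move=> s /andP[s2 st].
  have s0 : 0 <= s by lra. have sT : s < Tf by lra.
  have HK' r : 0 <= r <= Tf - s -> `|w r - w 0| <= K.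
    by move=> /andP[r0 rs]; apply: HK; rewrite r0; lra.
  have := dx_close s0 (lexx s) sT HK HK' K0 K0.
  rewrite ler_norml => /andP[_ H].
  have hs := hM s; rewrite s0 (ltW sT) in hs; have {}hs := hs isT.
  rewrite ler_norml in hs; move: hs => /andP[_ hs].
  have IsA : I s <= `|A|.
    by rewrite (le_trans (IA s _)) ?ler_norm//; apply/andP; split; lra.
  have : (w 0 + (K + K)) * I s <= (w 0 + (K + K)) * `|A|.
    by rewrite ler_wpM2l// !addr_ge0// ltW.
  by rewrite /L !mulrDl; lra.
have : \forall t \near Tf^'-, x (Tf / 2) + L * Tf + 1 <= x t.
  by move/cvgryPge : xy; exact.
have /andP[_ T2T] := T2.
move=> /(near_at_left T2T)[c /andP[c2 cT] /(_ c)].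
rewrite lexx cT => /(_ isT) H.
have := xL c; rewrite (ltW c2) cT => /(_ isT); lra.
Unshelve. all: by end_near. Qed.

(** For a fixed [a] close to [Tf], the terms [h t] and [K * I a] stay bounded and are negligible
    against [I t]; the mass after [a] meets a kernel within [e / 2] of [w 0]. *)
Let dx_I : dx t / I t @[t --> Tf^'-] --> w 0.
Proof.
apply/cvgrPdist_le => e e0.
have e2 : 0 < e / 2 by rewrite divr_gt0.
have [K K0 HK] := wK.
have [Mh Mh0 hM] := segment_bounded (ltW Tf0) ch.
have [d d0 wd] : exists2 d, 0 < d & forall s, 0 <= s <= d -> `|w s - w 0| <= e / 2.
  have /cvgrPdist_le /(_ _ e2) /nbhs_normP[r /= r0 H] : w s @[s --> (0 : R)] --> w 0.
    exact: cw.
  exists (r / 2); first by rewrite divr_gt0.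
  move=> s /andP[s0 sr]; rewrite distrC; apply: H => /=.
  by rewrite sub0r normrN ger0_norm//; lra.
pose a := Num.max 0 (Tf - d).
have a0 : 0 <= a by rewrite /a le_max lexx.
have aT : a < Tf by rewrite /a gt_max Tf0; lra.
have ad : Tf - a <= d by rewrite lerBlDr -lerBlDl /a le_max lexx orbT.
near=> t.
have at_ : a <= t by apply: ltW; near: t; exact: nbhs_left_gt.
have tT : t < Tf by near: t; exact: nbhs_left_lt.
have I1 : 1 <= I t by near: t; move/cvgryPge : I_cvgy; exact.
have IC : (Mh + K * I a) / (e / 2) <= I t by near: t; move/cvgryPge : I_cvgy; exact.
rewrite ler_pdivrMr// in IC.
have I0 : 0 < I t by exact: lt_le_trans I1.
have t0 := le_trans a0 at_.
have we s : 0 <= s <= Tf - a -> `|w s - w 0| <= e / 2.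
  by move=> /andP[s0 sT]; apply: wd; rewrite s0; lra.
have := dx_close a0 at_ tT HK we (ltW e2) K0.
have := hM t; rewrite t0 (ltW tT) => /(_ isT) => hs H.
rewrite -[X in `|X|](_ : (w 0 * I t - dx t) / I t = _); last first.
  by rewrite mulrBl mulfK// gt_eqF.
rewrite normrM normfV (gtr0_norm I0) ler_pdivrMr// distrC.
rewrite (_ : dx t - w 0 * I t = h t + (dx t - h t - w 0 * I t)); last by ring.
rewrite (le_trans (ler_normD _ _))//; lra.
Unshelve. all: by end_near. Qed.

Let is_derive_Fx t : 0 < t < Tf -> is_derive t 1 (fun s => Fint f (x s)) (f (x t) * dx t).
Proof.
move=> /andP[t0 tT].
have xt : 0 < x t by apply: x_gt0; rewrite ltW.
exact: is_derive1_comp (is_derive_Fint pcf osg xt) (sol_is_derive sol t0 (fin tT)).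
Qed.

(** The derivatives of numerator and denominator are [f (x t) * dx t] and [2 * I t * f (x t)], so
    the factor [f (x t)] cancels and half of [dx_I] remains. *)
Let Fx_I : Fint f (x t) / (I t * I t) @[t --> Tf^'-] --> w 0 / 2.
Proof.
have /(near_at_left Tf0)[a /andP[a0 aT] I1] : \forall t \near Tf^'-, 1 <= I t.
  by move/cvgryPge : I_cvgy; exact.
apply: (@lhopital_infty_left _ (fun t => f (x t) * dx t) _
  (fun t => I t * f (x t) + I t * f (x t)) a) => //.
- by move=> t /andP[at_ tT]; apply: is_derive_Fx; rewrite tT (lt_trans a0).
- move=> t /andP[at_ tT]; have dI : is_derive t 1 I (f (x t)).
    by apply: is_derive_I; rewrite tT (lt_trans a0).
  exact: (is_deriveM dI dI).
- move=> t /andP[at_ tT]; have It : 0 < I t.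
    by apply: lt_le_trans (I1 t _) => //; rewrite tT ltW.
  have fx : 0 < f (x t) by case: pcf => _; apply; apply: x_gt0; rewrite tT andbT; lra.
  by rewrite addr_gt0// mulr_gt0.
- apply/cvgryPge => A; near=> t.
  have H1 : 1 <= I t by near: t; move/cvgryPge : I_cvgy; exact.
  have HA : A <= I t by near: t; move/cvgryPge : I_cvgy; exact.
  by apply: (le_trans HA); rewrite ler_peMl// (le_trans ler01).
- have : dx t / I t / 2 @[t --> Tf^'-] --> w 0 / 2.
    by apply: cvgM => //; exact: cvg_cst.
  apply: cvg_trans; apply: near_eq_cvg; near=> t.
  have at_ : a < t by near: t; exact: nbhs_left_gt.
  have tT : t < Tf by near: t; exact: nbhs_left_lt.
  have It : 0 < I t by apply: lt_le_trans (I1 t _) => //; rewrite tT ltW.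
  have fx : 0 < f (x t) by case: pcf => _; apply; apply: x_gt0; rewrite tT andbT; lra.
  rewrite -mulr2n -[_ *+ 2]mulr_natr mulrC; field.
  by rewrite !gt_eqF.
Unshelve. all: by end_near. Qed.

(** Dividing [dx_I] by the square root of [Fx_I] eliminates [I]; the limit is
    [w 0 / Num.sqrt (w 0 / 2)]. *)
Let dx_sqrtF : dx t / Num.sqrt (Fint f (x t)) @[t --> Tf^'-] --> Num.sqrt (2 * w 0).
Proof.
have s0 : 0 < Num.sqrt (w 0 / 2) by rewrite sqrtr_gt0 divr_gt0.
have E : Num.sqrt (2 * w 0) = w 0 / Num.sqrt (w 0 / 2).
  apply: (mulIf (lt0r_neq0 s0)); rewrite divfK ?gt_eqF//.
  rewrite -sqrtrM; last by rewrite mulr_ge0// ltW.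
  rewrite [X in Num.sqrt X](_ : _ = w 0 ^+ 2); last by field.
  by rewrite sqrtr_sqr gtr0_norm.
have : dx t / I t / Num.sqrt (Fint f (x t) / (I t * I t)) @[t --> Tf^'-] -->
    Num.sqrt (2 * w 0).
  rewrite E; apply: cvgM => //; apply: cvgV; first by rewrite gt_eqF.
  by apply: continuous_cvg Fx_I; exact: sqrt_continuous.
apply: cvg_trans; apply: near_eq_cvg; near=> t.
have t0 : 0 < t by near: t; exact: nbhs_left_gt.
have tT : t < Tf by near: t; exact: nbhs_left_lt.
have I1 : 1 <= I t by near: t; move/cvgryPge : I_cvgy; exact.
have I0 : 0 < I t by exact: lt_le_trans I1.
have xt : 0 < x t by apply: x_gt0; rewrite tT ltW.
have F0 := Fint_gt0 pcf osg xt.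
rewrite sqrtrM ?(ltW F0)// sqrtrV ?mulr_ge0 ?(ltW I0)// -expr2 sqrtr_sqr gtr0_norm//.
have sF : 0 < Num.sqrt (Fint f (x t)) by rewrite sqrtr_gt0.
by field; rewrite !gt_eqF.
Unshelve. all: by end_near. Qed.

(** Both terms of the quotient vanish at [Tf], and the quotient of their derivatives is the one in
    [dx_sqrtF]. *)
Lemma blowup_rate :
  FB f (x t) / (Tf - t) @[t --> Tf^'-] --> Num.sqrt (2 * w 0).
Proof.
apply: (@lhopital_at_left _ _ (fun t => - (dx t / Num.sqrt (Fint f (x t))))
  _ (fun=> -1) 0) => //.
- move=> t; rewrite in_itv/= => /andP[t0 tT].
  have xt : 0 < x t by apply: x_gt0; rewrite tT ltW.
  have H := is_derive1_comp (is_derive_FB pcf osg xt) (sol_is_derive sol t0 (fin tT)).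
  by apply: (is_derive_eq H); rewrite mulNr mulrC.
- move=> t _; have H := is_deriveB (@is_derive_cst _ R R Tf t 1) (@is_derive_id _ _ t 1).
  by apply: (is_derive_eq H); rewrite sub0r.
- exact: cvg_comp xy (FB_cvg0 pcf osg).
- have : Tf - t @[t --> Tf] --> Tf - Tf by apply: cvgB; [exact: cvg_cst|exact: cvg_id].
  by rewrite subrr => /cvg_at_left_filter.
- apply: cvg_trans dx_sqrtF; apply: near_eq_cvg; near=> t.
  by rewrite invrN invr1 mulrN1 opprK.
Unshelve. all: by end_near. Qed.

End Rate.

(** * Reduction to a kernel on the whole line, and conclusion *)

Lemma is_sol_eq_kernel (R : realType) (f w w' h : R -> R) (psi : R) (T : \bar R)
    (x : R -> R) : (forall t, 0 <= t -> w t = w' t) ->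
  is_sol f w h psi T x -> is_sol f w' h psi T x.
Proof.
move=> ww' [T0 x0 cx xp dx]; split => // t t0 tT.
apply: (is_derive_eq (dx t t0 tT)); congr (_ + _).
apply: eq_Rintegral => s; rewrite inE/= in_itv/= => /andP[_ st].
by rewrite ww'// subr_ge0.
Qed.

Theorem theorem4p1 (R : realType) (f w h : R -> R) :
  pos_cont f -> asympt_increasing f ->
  (f x / x @[x --> +oo] --> +oo) ->
  {within `[0, +oo[, continuous w} -> (forall t, 0 <= t -> 0 <= w t) -> 0 < w 0 ->
  continuous h -> (forall t, 0 <= t -> 0 <= Hint h t) ->
  osgood_cond f ->
  (forall (psi : R) (T : \bar R) (x : R -> R), 0 < psi ->
     is_max_sol f w h psi T x ->
     exists Tf : R, T = Tf%:E /\ `|x t| @[t --> Tf^'-] --> +oo) /\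
  (preserves_superexp f -> incr_pos f ->
   forall (psi : R) (Tf : R) (x : R -> R), 0 < psi ->
     is_max_sol f w h psi Tf%:E x ->
     FB f (x t) / (Tf - t) @[t --> Tf^'-] --> Num.sqrt (2 * w 0)).
Proof.
move=> pcf asf fsup cw w_ge0 w00 ch H_ge0 osg.
(* The equation evaluates the kernel only at nonnegative lags, so [w] may be extended by [w 0] to
   negative arguments. *)
pose w' t := w (Num.max t 0).
have cw' : continuous w'.
  apply: (continuous_comp_within cw).
    by apply: continuous_funmax; [exact: continuous_funid|exact: continuous_funcst].
  by move=> t; rewrite /= in_itv/= andbT le_max lexx orbT.
have w'_ge0 t : 0 <= w' t by apply: w_ge0; rewrite le_max lexx orbT.
have ww' t : 0 <= t -> w t = w' t by move=> t0; rewrite /w' max_l.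
have w'w t : 0 <= t -> w' t = w t by move=> t0; rewrite ww'.
have w'0 : 0 < w' 0 by rewrite w'w.
(* A longer solution for [w'] is also one for [w], so maximality carries over. *)
have max' psi T x : is_max_sol f w h psi T x -> is_max_sol f w' h psi T x.
  move=> [sol nex]; split; first exact: is_sol_eq_kernel sol.
  move=> [T' [y [TT' [ysol yx]]]]; apply: nex; exists T', y; split => //; split => //.
  exact: is_sol_eq_kernel ysol.
have blow psi (Tf : R) x : 0 < psi -> is_max_sol f w' h psi Tf%:E x ->
    x t @[t --> Tf^'-] --> +oo.
  move=> psi0 mx; have [sol _] := mx.
  exact: (maximal_sol_blowup pcf cw' w'_ge0 ch H_ge0 psi0 sol mx).
split.
  move=> psi T x psi0 /max' mx; have [sol _] := mx.
  have [k k0 fk] := quasi_increasing pcf asf psi0.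
  have [d d0 wd] : exists2 d, 0 < d & forall s, 0 <= s <= d -> w' 0 / 2 <= w' s.
    have : \forall s \near (0 : R), w' 0 / 2 < w' s.
      by apply: (@cvgr_gt _ _ (nbhs (0 : R)) _ w' (w' 0)); [exact: cw'|lra].
    move=> /nbhs_normP[e /= e0 H]; exists (e / 2); first by rewrite divr_gt0.
    move=> s /andP[s0 se]; apply: ltW; apply: H => /=.
    by rewrite sub0r normrN ger0_norm//; lra.
  have m0 : 0 < w' 0 / 2 by rewrite divr_gt0.
  have Tfin := sol_finite pcf osg psi0 k0 fk cw' w'_ge0 ch H_ge0 sol m0 d0 wd fsup.
  (* The value [+oo] is excluded by [sol_finite], and [-oo] by the positivity of [T]. *)
  case: T mx sol Tfin => [Tf mx sol _|_ _ /eqP//|_ [+ _ _ _ _]]; last by rewrite ltNge leNye.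
  exists Tf; split => //; have xy := blow _ _ _ psi0 mx.
  apply/cvgryPge => A; near=> t.
  apply: le_trans (ler_norm (x t)).
  by near: t; move/cvgryPge : xy; exact.
move=> _ _ psi Tf x psi0 /max' mx; have [sol _] := mx.
rewrite -w'w//; apply: (blowup_rate pcf osg cw' w'_ge0 w'0 ch sol).
exact: blow mx.
Unshelve. all: by end_near. Qed.
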